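(* In the canonical normal linear prediction model, with the hierarchical prior $\pi(\theta,\mu,\eta)$ for $\alpha=1$ described in the context ($a>-k/2-1$, $c_i\ge1$ for all $i$, $\gamma\ge1$), the generalized Bayes predictive distribution under $D_1$ divergence with respect to this prior is the normal distribution $N_m(Q\hat\theta_{\nu,C},\hat\sigma^2_{\nu,C}I_m)$, where $$\hat\theta_{\nu,C}=\left(I_l-\frac{\nu}{\nu+1+W}C^{-1}\right)V,\qquad \hat\sigma^2_{\nu,C}=\left(1-\frac{\nu}{\nu+1+W}\right)\frac{S}{n-k},$$ with $W=\{V'C^{-1}D^{-1}V+\|V_*\|^2/\gamma\}/S$ and $\nu=(k+2a+2)/(n-k)$. When $m\ge k$ the term $\|V_*\|^2/\gamma$ is omitted.
   Context: Canonical model. Let $n>k\ge1$ and $m\ge1$ be integers and $l=\min(k,m)$. One observes independent $$V\sim N_l(\theta,\eta^{-1}D),\qquad V_*\sim N_{k-l}(\mu,\eta^{-1}I_{k-l}),\qquad \eta S\sim\chi^2_{n-k},$$ where $\theta\in\mathbb{R}^l$, $\mu\in\mathbb{R}^{k-l}$ and $\eta=\sigma^{-2}>0$ are unknown, and $D=\mathrm{diag}(d_1,\dots,d_l)$ is known with $d_1\ge\dots\ge d_l>0$. When $m\ge k$ (so $l=k$), $V_*$ and $\mu$ are empty. The future observation is $\tilde Y\sim N_m(Q\theta,\eta^{-1}I_m)$, conditionally independent of $(V,V_*,S)$ given the parameters, where $Q$ is a known $m\times l$ matrix with $Q'Q=I_l$. A prime denotes transpose. Write $y$ for the data $(V,V_*,S)$,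 $\psi=(\theta,\mu,\eta)$, and $p(\tilde y|\psi)$ for the density of $\tilde Y$. Prior (case $\alpha=1$). The (possibly improper) prior density $\pi(\theta,\mu,\eta)$ is given hierarchically by $$\theta|\eta,\lambda\sim N_l\left(0,\eta^{-1}D(C/\lambda-I_l)\right),\qquad \mu|\eta,\lambda\sim N_{k-l}\left(0,\eta^{-1}(\gamma/\lambda-1)I_{k-l}\right),$$ with $\theta$ and $\mu$ conditionally independent given $(\eta,\lambda)$, and with $\eta$ having (improper) density proportional to $\eta^a$ on $(0,\infty)$ and $\lambda$ having density proportional to $\lambda^a(1-\lambda)^b$ on $(0,1)$; i.e. $\pi(\theta,\mu,\eta)$ is the integral over $\lambda\in(0,1)$ of the product of the two conditional normal densities with $\eta^a\lambda^a(1-\lambda)^b$. Here $C=\mathrm{diag}(c_1,\dots,c_l)$ with $c_i\ge1$, $b=(n-k)/2-1$, $\gamma\ge1$, and $a>-k/2-1$. When $m\ge k$ the prior on $\mu$ is empty. Generalized Bayes predictive density under $D_1$. The divergence is $D_1\{\hat p,p\}=\int \hat p(\tilde y;y)\log\frac{\hat p(\tilde y;y)}{p(\tilde y|\psi)}\,d\tilde y$. The generalized Bayes predictive density under $D_1$ with respect to $\pi$ is the probability density in $\tilde y$ proportional to $\exp\left\{\int\log p(\tilde y|\psi)\,\pi(\psi|y)\,d\psi\right\}$, where $\pi(\psi|y)\propto p(v|\theta,\eta)p(v_*|\mu,\eta)p(s|\eta)\pi(\theta,\mu,\eta)$ is the posterior. *)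

(* Defs.v *)
From HB Require Import structures.
From mathcomp Require Import all_boot all_order all_algebra.
From mathcomp Require Import all_classical all_reals all_analysis.
Set Implicit Arguments.
Unset Strict Implicit.
Unset Printing Implicit Defensive.
Import Order.TTheory GRing.Theory Num.Theory.
Import numFieldNormedType.Exports.
Local Open Scope classical_set_scope.
Local Open Scope ring_scope.

Section lebesgue_tuple.
Variable R : realType.
Local Notation RT := (measurableTypeR R).

(* Points of R^n to be integrated over are n-tuples, because tuples carry the
   product sigma-algebra in the library; [colt] gives the column vector. *)
Definition colt (n : nat) (t : n.-tuple RT) : 'cV[R]_n :=
  \col_i (tnth t i : R).

Definition consp (n : nat) (p : RT * n.-tuple RT) : n.+1.-tuple RT :=
  cons_tuple p.1 p.2.

(* Lebesgue measure on R^n; on R^0 it is the unit mass at the empty tuple. *)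
Fixpoint lebesgue_tuple (n : nat) : set (n.-tuple RT) -> \bar R :=
  match n return set (n.-tuple RT) -> \bar R with
  | 0%N => dirac ([tuple] : 0.-tuple RT)
  | n'.+1 =>
      pushforward (lebesgue_measure \x lebesgue_tuple (n := n'))%E (@consp n')
  end.

End lebesgue_tuple.
Arguments lebesgue_tuple {R} n.

Section lebesgue_tuple_theory.
Variable R : realType.
Local Notation RT := (measurableTypeR R).

Lemma measurable_consp n : measurable_fun [set: RT * n.-tuple RT] (@consp R n).
Proof. exact: measurable_cons. Qed.

Let unconsp n (t : n.+1.-tuple RT) : RT * n.-tuple RT :=
  (thead t, [tuple of behead t]).

Let measurable_unconsp n :
  measurable_fun [set: n.+1.-tuple RT] (@unconsp n).
Proof.
apply: (measurable_fun_pair _ _) => /=.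
- exact: measurable_tnth.
- exact: measurable_behead.
Qed.

Let conspK n : cancel (@consp R n) (@unconsp n).
Proof.
by move=> [x t]; rewrite /unconsp /consp theadE; congr pair; exact/val_inj.
Qed.

Section prod_sfm.
Local Open Scope ereal_scope.
Context d1 d2 (T1 : measurableType d1) (T2 : measurableType d2).
Variables (m1 : {sigma_finite_measure set T1 -> \bar R})
          (m2 : {sigma_finite_measure set T2 -> \bar R}).

Lemma sigma_finite_prod : sigma_finite setT (m1 \x m2).
Proof.
have /sigma_finiteP[F [TF ndF Foo]] := sigma_finiteT m1.
have /sigma_finiteP[G [TG ndG Goo]] := sigma_finiteT m2.
exists (fun n => F n `*` G n).
  rewrite -setXTT TF TG predeqE => -[x y]; split.
    move=> [/= [n _ Fnx] [k _ Gky]]; exists (maxn n k) => //; split.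
    - by move: x Fnx; exact/subsetPset/ndF/leq_maxl.
    - by move: y Gky; exact/subsetPset/ndG/leq_maxr.
  by move=> [n _ []/= ? ?]; split; exists n.
move=> k; have [? ?] := Foo k; have [? ?] := Goo k.
split; first exact: measurableX.
by rewrite product_measure1E// lte_mul_pinfty// ge0_fin_numE.
Qed.

Let mprod : {measure set (T1 * T2)%type -> \bar R} := (m1 \x m2).
Let mixin := Measure_isSigmaFinite.Build _ _ _ mprod sigma_finite_prod.

Definition prod_sfm : {sigma_finite_measure set (T1 * T2)%type -> \bar R} :=
  HB.pack_for (sigma_finite_measure (T1 * T2)%type R)
    (mprod : set _ -> \bar R) mprod mixin.

End prod_sfm.

Lemma lebesgue_tuple_sfm n :
  exists m : {sigma_finite_measure set (n.-tuple RT) -> \bar R},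
    lebesgue_tuple n = m :> (_ -> _).
Proof.
elim: n => [|n [m mE]].
  by exists (dirac ([tuple] : 0.-tuple RT)).
pose P := prod_sfm lebesgue_measure m.
pose p : {measure set (n.+1.-tuple RT) -> \bar R} :=
  measure_function_pushforward__canonical__measure_function_Measure
    P (@measurable_consp n).
have sp : sigma_finite setT p.
  have [F FT Ffin] := sigma_finiteT P.
  exists (fun i => @unconsp n @^-1` F i).
    by rewrite -preimage_bigcup -FT preimage_setT.
  move=> i; have [mF Foo] := Ffin i; split.
    by rewrite -[X in measurable X]setTI; exact: measurable_unconsp.
  rewrite /p /= /pushforward -comp_preimage (_ : _ \o _ = id)//.
  exact/funext/conspK.
pose sm := Measure_isSigmaFinite.Build _ _ _ p sp.
pose q : {sigma_finite_measure set (n.+1.-tuple RT) -> \bar R} :=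
  HB.pack_for (sigma_finite_measure (n.+1.-tuple RT) R)
    (p : set _ -> \bar R) p sm.
exists q.
by rewrite /= mE.
Qed.

Let lebesgue_tuple0 n : lebesgue_tuple n set0 = 0%E :> \bar R.
Proof. by have [m ->] := lebesgue_tuple_sfm n; rewrite measure0. Qed.

Let lebesgue_tuple_ge0 n (A : set (n.-tuple RT)) : (0 <= lebesgue_tuple n A)%E.
Proof. by have [m ->] := lebesgue_tuple_sfm n; exact: measure_ge0. Qed.

Let lebesgue_tuple_sigma_additive n :
  semi_sigma_additive (lebesgue_tuple n : set (n.-tuple RT) -> \bar R).
Proof.
by have [m ->] := lebesgue_tuple_sfm n; exact: measure_semi_sigma_additive.
Qed.

HB.instance Definition _ n := isMeasure.Build _ (n.-tuple RT) R
  (lebesgue_tuple n) (lebesgue_tuple0 n) (@lebesgue_tuple_ge0 n)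
  (@lebesgue_tuple_sigma_additive n).

Let lebesgue_tuple_sigma_finite n :
  sigma_finite setT (lebesgue_tuple n : set (n.-tuple RT) -> \bar R).
Proof. by have [m ->] := lebesgue_tuple_sfm n; exact: sigma_finiteT. Qed.

HB.instance Definition _ n := Measure_isSigmaFinite.Build _ (n.-tuple RT) R
  (lebesgue_tuple n) (@lebesgue_tuple_sigma_finite n).

End lebesgue_tuple_theory.

Section densities.
Variable R : realType.

(* Density of N_n(mean, Sigma), Sigma positive definite. *)
Definition mvn_pdf (n : nat) (mean : 'cV[R]_n) (Sigma : 'M[R]_n)
    (x : 'cV[R]_n) : R :=
  (Num.sqrt (\det ((2 * pi) *: Sigma)))^-1 *
  expR (- (((x - mean)^T *m invmx Sigma *m (x - mean)) ord0 ord0) / 2).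

Definition Gamma (z : R) : R :=
  \int[lebesgue_measure]_(t in `]0, +oo[) (t `^ (z - 1) * expR (- t)).

Definition chi2_pdf (r : nat) (x : R) : R :=
  if 0 < x then
    x `^ (r%:R / 2 - 1) * expR (- x / 2) / (2 `^ (r%:R / 2) * Gamma (r%:R / 2))
  else 0.

End densities.

Section generalized_Bayes.
Local Open Scope ereal_scope.
Context (R : realType) (d : measure_display) (Psi : measurableType d).
(* [mu] is the reference measure on the parameter space [Theta],
   [lik psi] the density of the observed data, and [prior] the possibly
   improper prior density, which may be infinite on a null set. *)
Variables (mu : set Psi -> \bar R) (Theta : set Psi).
Variables (lik : Psi -> R) (prior : Psi -> \bar R).

Definition marginal : \bar R :=
  \int[mu]_(psi in Theta) ((lik psi)%:E * prior psi).

Definition posterior (psi : Psi) : \bar R :=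
  (lik psi)%:E * prior psi * ((fine marginal)^-1)%:E.

(* [p yt psi] is the density of the future observation at [yt]. *)
Variables (m : nat) (p : 'cV[R]_m -> Psi -> R).

Definition post_log (yt : 'cV[R]_m) (psi : Psi) : \bar R :=
  (ln (p yt psi))%:E * posterior psi.

Definition exp_post_log (yt : 'cV[R]_m) : R :=
  expR (fine (\int[mu]_(psi in Theta) post_log yt psi)).

Definition D1_predictive (yt : 'cV[R]_m) : R :=
  (exp_post_log yt /
   fine (\int[lebesgue_tuple m]_z (exp_post_log (colt z))%:E))%R.

End generalized_Bayes.

Section canonical_model.
Variable R : realType.
Local Notation RT := (measurableTypeR R).

Section parameters.
(* psi = (theta, mu, eta) with theta in R^l, mu in R^q and eta > 0.  When
   q = 0 there is a single value of mu, and densities on R^0 are equal to 1. *)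
Variables l q : nat.
Local Notation Psi := (l.-tuple RT * q.-tuple RT * RT)%type.

Definition theta_of (psi : Psi) : 'cV[R]_l := colt psi.1.1.
Definition mu_of (psi : Psi) : 'cV[R]_q := colt psi.1.2.
Definition eta_of (psi : Psi) : R := psi.2.

Definition param_space : set Psi := [set psi | 0 < eta_of psi].

Definition param_measure : set Psi -> \bar R :=
  (lebesgue_tuple l \x lebesgue_tuple q \x lebesgue_measure)%E.

(* The density of S, when eta * S is chi-square with r degrees of freedom, is
   s |-> eta * chi2_pdf r (eta * s). *)
Definition likelihood (r : nat) (D : 'M[R]_l) (v : 'cV[R]_l) (vs : 'cV[R]_q)
    (s : R) (psi : Psi) : R :=
  let eta := eta_of psi in
  mvn_pdf (theta_of psi) (eta^-1 *: D) v *
  mvn_pdf (mu_of psi) (eta^-1)%:M vs *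
  (eta * chi2_pdf r (eta * s)).

Definition hier_prior (D C : 'M[R]_l) (gamma a b : R) (psi : Psi) : \bar R :=
  let eta := eta_of psi in
  (\int[lebesgue_measure]_(lam in `]0%R, 1%R[)
    (mvn_pdf 0 (eta^-1 *: (D *m (lam^-1 *: C - 1%:M))) (theta_of psi) *
     mvn_pdf 0 (eta^-1 * (gamma / lam - 1))%:M (mu_of psi) *
     (eta `^ a * (lam `^ a * (1 - lam) `^ b)))%:E)%E.

Definition future_pdf (m : nat) (Q : 'M[R]_(m, l)) (yt : 'cV[R]_m)
    (psi : Psi) : R :=
  mvn_pdf (Q *m theta_of psi) ((eta_of psi)^-1)%:M yt.

End parameters.

Section estimators.
Variables (l q r : nat) (D C : 'M[R]_l) (gamma nu : R).
Variables (v : 'cV[R]_l) (vs : 'cV[R]_q) (s : R).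

Definition W_stat : R :=
  ((v^T *m invmx C *m invmx D *m v) ord0 ord0 +
   (\sum_(i < q) vs i ord0 ^+ 2) / gamma) / s.

Definition theta_hat : 'cV[R]_l :=
  (1%:M - (nu / (nu + 1 + W_stat)) *: invmx C) *m v.

Definition sigma2_hat : R := (1 - nu / (nu + 1 + W_stat)) * (s / r%:R).

End estimators.

End canonical_model.
Arguments param_space R l q : clear implicits.
Arguments param_measure R l q : clear implicits.

(* Main.v *)
Require Import Defs.
From mathcomp Require Import all_boot all_order all_algebra.
From mathcomp Require Import all_classical all_reals all_analysis.
From mathcomp Require Import measurable_realfun ring lra.
Import Order.TTheory GRing.Theory Num.Theory.
Import numFieldNormedType.Exports.
Local Open Scope classical_set_scope.
Local Open Scope ring_scope.

(** Given (eta, lambda), normal conjugacy makes the posterior of (theta, mu) a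
    product of normal laws, theta_j having mean (1 - lambda / c_j) v_j and
    variance d_j (1 - lambda / c_j) / eta. What is left of the joint density
    is, up to a constant, the density of two independent gamma variables
    x = lambda eta and y = (1 - lambda) eta, of shapes k/2 + a + 1 and
    (n - k)/2 and rates S (1 + W) / 2 and S / 2. Since Q'Q = I, the posterior
    expectation of eta |y~ - Q theta|^2 is a linear combination of moments of
    (x, y) whose dependence on y~ only involves E x and E y; completing the
    square yields a Gaussian with precision E x + E y and shrinkage factor
    E x / (E x + E y) = nu / (nu + 1 + W). *)

(** Two obstacles shape the proof. The integrand, log density times posterior, has no constant sign;
    and the prior, being an integral over lambda, can be infinite at some points (at theta = 0, mu =
    0 if all c_i and gamma are 1 and n - k <= k). So on the parameter space only nonnegative
    extended-real functions are integrated, by Tonelli, and a single subtraction is made at the end,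
    where finiteness almost everywhere of the posterior is available. Much is only shown to be
    finite and never evaluated: the expectations of log eta, of lambda and of lambda x, and even the
    variance of the standard normal law. None of them multiplies a function of y~, so they all end
    in an additive constant of the exponent that the normalisation of the predictive density
    removes. Only E x and E y need a value, and for gamma laws they follow from the recurrence
    between the shapes z and z + 1. *)

Set Implicit Arguments.
Unset Strict Implicit.
Unset Printing Implicit Defensive.

(** * Affine change of variable on the line *)

Section affine.
Context {R : realType}.
Local Notation mu := (@lebesgue_measure R).
Local Open Scope ereal_scope.

Let aff (a b t : measurableTypeR R) : measurableTypeR R := (a * t + b)%R.

Let measurable_aff a b : measurable_fun setT (aff a b).
Proof. by apply: measurable_funD => //; exact: measurable_funM. Qed.

(** The image of Lebesgue measure under t |-> a t + b, scaled by |a|, gives half-open intervals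
    their length, so it is Lebesgue measure by uniqueness; the formula then holds for every
    nonnegative measurable f, with infinite values allowed. *)
Lemma ge0_integral_affine (a b : R) (f : R -> \bar R) : (a != 0)%R ->
  measurable_fun setT f -> (forall x, 0 <= f x) ->
  \int[mu]_x f x = `|a|%:E * \int[mu]_x f (a * x + b)%R.
Proof.
move=> a0 mf f0.
pose p : {measure set (measurableTypeR R) -> \bar R} :=
  measure_function_pushforward__canonical__measure_function_Measure
    mu (measurable_aff a b).
have a_ge0 : (0 <= `|a|)%R by [].
pose q : {measure set (measurableTypeR R) -> \bar R} := mscale (NngNum a_ge0) p.
have muq A : measurable A -> mu A = q A.
  apply: lebesgue_measure_unique => X [[x y] /= xy <-].
  rewrite /q /= /mscale /= /pushforward lebesgue_measure_itv/= lte_fin.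
  have [ap|an|aE] := ltgtP 0%R a; last by rewrite -aE eqxx in a0.
  - rewrite (_ : aff a b @^-1` _ = `](x - b) / a, (y - b) / a]%classic)%R; last first.
      apply/seteqP; split=> t /=; rewrite !in_itv/= ltr_pdivrMr// ler_pdivlMr//;
        by rewrite ltrBlDr lerBrDr (mulrC t).
    rewrite lebesgue_measure_itv/= lte_fin ltr_pM2r ?invr_gt0// ltrD2r.
    case: ifP => _; last by rewrite mule0.
    by rewrite gtr0_norm// -!EFinD -EFinM; congr EFin; field.
  - rewrite (_ : aff a b @^-1` _ = `[(y - b) / a, (x - b) / a[%classic)%R; last first.
      apply/seteqP; split=> t /=; rewrite !in_itv/= ltr_ndivlMr// ler_ndivrMr//;
        by rewrite ltrBlDr lerBrDr (mulrC t) andbC.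
    rewrite lebesgue_measure_itv/= lte_fin ltr_nM2r ?invr_lt0// ltrD2r.
    case: ifP => _; last by rewrite mule0.
    by rewrite ltr0_norm// -!EFinD -EFinM; congr EFin; field.
rewrite (eq_measure_integral q); last by move=> A mA _; exact: muq.
rewrite /q ge0_integral_mscale//=; congr (_ * _).
rewrite ge0_integral_pushforward//.
Qed.

End affine.

(** * Closure properties of measurable functions and their automation *)

Section measurability.
Context d (T : measurableType d) {R : realType}.
Implicit Types f g : T -> R.

Lemma measurable_fun_expR f :
  measurable_fun setT f -> measurable_fun setT (fun x => expR (f x)).
Proof. by move=> mf; exact: measurableT_comp. Qed.

Lemma measurable_fun_ln f :
  measurable_fun setT f -> measurable_fun setT (fun x => ln (f x)).
Proof. by move=> mf; exact: measurableT_comp. Qed.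

Lemma measurable_fun_powR f a :
  measurable_fun setT f -> measurable_fun setT (fun x => f x `^ a).
Proof. by move=> mf; exact: (measurableT_comp (@measurable_powR _ a)). Qed.

(** The square root is the power 1/2 on positive reals. Nonpositive values are first cut off to 0,
    because at negative numbers [powR] does not vanish whereas [Num.sqrt] does. *)
Lemma measurable_fun_sqrt f :
  measurable_fun setT f -> measurable_fun setT (fun x => Num.sqrt (f x)).
Proof.
move=> mf; rewrite (_ : (fun x => _) =
    fun x => (if 0 < f x then f x else 0) `^ 2^-1).
  apply: measurable_fun_powR; apply: measurable_fun_ifT => //.
  exact: measurable_fun_ltr.
apply/funext => x; case: ltP => fx; first by rewrite powR12_sqrt// ltW.
by rewrite powR0 ?invr_eq0 ?pnatr_eq0// ler0_sqrtr.
Qed.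

(** Writing 1/u as u (u^2)^(-1) gives [powR] a nonnegative base whatever the sign of u; at u = 0
    both sides are 0 by convention. *)
Lemma measurable_fun_inv f :
  measurable_fun setT f -> measurable_fun setT (fun x => (f x)^-1).
Proof.
move=> mf; rewrite (_ : (fun x => _) = fun x => f x * (f x ^+ 2) `^ (-1)).
  apply: measurable_funM => //; apply: measurable_fun_powR.
  exact: measurable_funX.
apply/funext => x; rewrite powR_inv1 ?sqr_ge0//.
have [->|f0] := eqVneq (f x) 0; first by rewrite invr0 mul0r.
by rewrite expr2 invfM mulrA divff// mul1r.
Qed.

Lemma measurable_fun_ifpos f g : measurable_fun setT f ->
  measurable_fun setT g -> measurable_fun setT (fun x => if 0 < g x then f x else 0).
Proof.
by move=> mf mg; apply: measurable_fun_ifT => //; exact: measurable_fun_ltr.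
Qed.

Lemma measurable_fun_opp f :
  measurable_fun setT f -> measurable_fun setT (fun x => - f x).
Proof. by move=> mf; exact: measurable_funN. Qed.

End measurability.

Lemma measurable_fun_fst d d1 d2 (T : measurableType d) (T1 : measurableType d1)
    (T2 : measurableType d2) (f : T -> T1 * T2) :
  measurable_fun setT f -> measurable_fun setT (fun x => (f x).1).
Proof. exact: (measurableT_comp measurable_fst). Qed.

Lemma measurable_fun_snd d d1 d2 (T : measurableType d) (T1 : measurableType d1)
    (T2 : measurableType d2) (f : T -> T1 * T2) :
  measurable_fun setT f -> measurable_fun setT (fun x => (f x).2).
Proof. exact: (measurableT_comp measurable_snd). Qed.

(** Extension point of [mfun], redefined below each time a new family of integrands has been shown
    measurable. *)
Ltac mfun_hook := fail.

Ltac mfun := lazymatch goal with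
  | |- measurable_fun _ (fun x => EFin _) => apply/measurable_EFinP; mfun
  | |- measurable_fun _ (fun x => expR (@?f x)) =>
      refine (@measurable_fun_expR _ _ _ f _); mfun
  | |- measurable_fun _ (fun x => ln (@?f x)) =>
      refine (@measurable_fun_ln _ _ _ f _); mfun
  | |- measurable_fun _ (fun x => powR (@?f x) ?a) =>
      refine (@measurable_fun_powR _ _ _ f a _); mfun
  | |- measurable_fun _ (fun x => Num.sqrt (@?f x)) =>
      refine (@measurable_fun_sqrt _ _ _ f _); mfun
  | |- measurable_fun _ (fun x => GRing.inv (@?f x)) =>
      refine (@measurable_fun_inv _ _ _ f _); mfun
  | |- measurable_fun _ (fun x => GRing.opp (@?f x)) =>
      refine (@measurable_fun_opp _ _ _ f _); mfun
  | |- measurable_fun _ (fun x => GRing.exp (@?f x) ?n) =>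
      refine (@measurable_funX _ _ _ _ f n _); mfun
  | |- measurable_fun _ (fun x => GRing.add (@?f x) (@?g x)) =>
      refine (@measurable_funD _ _ _ _ f g _ _); mfun
  | |- measurable_fun _ (fun x => GRing.mul (@?f x) (@?g x)) =>
      refine (@measurable_funM _ _ _ _ f g _ _); mfun
  | |- measurable_fun _ (fun x => fst (@?f x)) =>
      refine (@measurable_fun_fst _ _ _ _ _ _ f _); mfun
  | |- measurable_fun _ (fun x => snd (@?f x)) =>
      refine (@measurable_fun_snd _ _ _ _ _ _ f _); mfun
  | |- measurable_fun _ (fun x => x) => exact: measurable_id
  | |- _ => first [by [] | mfun_hook; mfun | idtac]
  end.

(** * Unnormalised gamma densities and their total mass *)

Section gamma_density.
Context {R : realType}.
Local Notation mu := (@lebesgue_measure R).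
Implicit Types (z c t u : R).

Definition gamma_density z c t : R :=
  if 0 < t then t `^ (z - 1) * expR (- (c * t)) else 0.

Lemma gamma_density_ge0 z c t : 0 <= gamma_density z c t.
Proof. by rewrite /gamma_density; case: ifP => // _; rewrite mulr_ge0 ?powR_ge0 ?expR_ge0. Qed.

Lemma measurable_gamma_density d (T : measurableType d) z c (f : T -> R) :
  measurable_fun setT f -> measurable_fun setT (fun x => gamma_density z c (f x)).
Proof. by move=> mf; apply: measurable_fun_ifpos => //; mfun. Qed.

Definition gamma_mass z c : \bar R := (\int[mu]_t (gamma_density z c t)%:E)%E.

Lemma gamma_mass_ge0 z c : (0 <= gamma_mass z c)%E.
Proof. by apply: integral_ge0 => t _; rewrite lee_fin gamma_density_ge0. Qed.

(** This turns a first moment into a total mass for the next shape. *)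
Lemma gamma_densityS z c t :
  gamma_density (z + 1) c t = t * gamma_density z c t.
Proof.
rewrite /gamma_density; case: ifPn => [t0|_]; last by rewrite mulr0.
rewrite mulrA; congr (_ * _).
have -> : z + 1 - 1 = 1 + (z - 1) by rewrite addrAC addrC.
by rewrite (powRD (r := 1)) ?(gt_eqF t0) ?implybT// powRr1// ltW.
Qed.

Lemma integral_expR_tail c u : 0 < c -> (\int[mu]_(t in `[u, +oo[)
  (expR (- (c * t)))%:E = (expR (- (c * u)) / c)%:E)%E.
Proof.
move=> c0.
have dF (x : R) : is_derive x (1:R) (fun t => - (expR (- (c * t)) / c)) (expR (- (c * x))).
  apply: is_derive_eq; by rewrite /GRing.scale/=; field; rewrite gt_eqF.
rewrite (@ge0_continuous_FTC2y _ (fun t => expR (- (c * t))) (fun t => - (expR (- (c * t)) / c)) u 0).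
- by rewrite sub0e -EFinN opprK.
- by move=> x _; exact: expR_ge0.
- apply: continuous_subspaceT => x.
  apply: continuous_comp; last exact: continuous_expR.
  by apply: continuousN; apply: continuousM => //; exact: cvg_cst.
- rewrite -oppr0 -(mul0r c^-1); apply: cvgN; apply: cvgM; last exact: cvg_cst.
  apply: (@cvg_comp _ _ _ (fun t => c * t) (fun z => expR (- z)) _ (pinfty_nbhs R)).
    exact: gt0_cvgMry.
  exact: cvgr_expR.
- by move=> x _; have [] := dF x.
- have cF : {for u, continuous (fun t => - (expR (- (c * t)) / c))}.
    apply: differentiable_continuous.
    by apply/derivable1_diffP; have [] := dF u.
  by apply: cvg_at_right_filter; exact: cF.
- by move=> x _; rewrite derive1E; have [] := dF x.
Qed.

(** For z < 1 the integrand is unbounded at 0. The fundamental theorem is therefore applied on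
    compact intervals away from 0, followed by monotone convergence and t^z --> 0 at 0. *)
Lemma integral_powR_itv z u : 0 < z -> 0 < u ->
  (\int[mu]_(t in `]0%R, u[) (t `^ (z - 1))%:E = (u `^ z / z)%:E)%E.
Proof.
move=> z0 u0.
(* Dividing by n + 2 keeps the left end strictly below u already for n = 0, as the fundamental
   theorem demands. *)
pose F n := (`[u / n.+2%:R, u]%classic : set R).
have FE : \bigcup_n F n = `]0%R, u]%classic.
  apply/seteqP; split=> t /=.
    move=> [n _]; rewrite /F /= ?in_itv/= => /andP[nt tu]; rewrite ?in_itv/= tu andbT.
    by rewrite (lt_le_trans _ nt)// divr_gt0.
  rewrite ?in_itv/= => /andP[t0 tu].
  exists (Num.bound (u / t)) => //; rewrite /F/= ?in_itv/= tu andbT.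
  rewrite ler_pdivrMr// mulrC -ler_pdivrMr//.
  apply: (le_trans (ltW (archi_boundP _))); first by rewrite divr_ge0// ltW.
  by rewrite ler_nat; exact: leqW (leqnSn _).
have mpow (A : set R) : measurable_fun A (fun t : R => (t `^ (z - 1))%:E).
  by apply: measurable_funTS; mfun.
have -> : (\int[mu]_(t in `]0%R, u[) (t `^ (z - 1))%:E
    = \int[mu]_(t in `]0%R, u]) (t `^ (z - 1))%:E)%E.
  exact: integral_itv_bndo_bndc.
rewrite -FE.
have cvg1 : (\int[mu]_(t in F n) (t `^ (z - 1))%:E @[n --> \oo] -->
    \int[mu]_(t in \bigcup_n F n) (t `^ (z - 1))%:E)%E.
  apply: ge0_nondecreasing_set_cvg_integral => //.
  - apply/nondecreasing_seqP => n; apply/subsetPset => t; rewrite /F /= !in_itv/=.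
    move=> /andP[nt ->]; rewrite andbT (le_trans _ nt)//.
    by rewrite ler_pM2l// lef_pV2 ?posrE// ler_nat.
  - by move=> n; exact: measurable_itv.
  - by move=> n; exact: mpow.
  - by move=> n t _; rewrite lee_fin powR_ge0.
rewrite -(cvg_lim _ cvg1)//; apply: cvg_lim => //.
have IE n : (\int[mu]_(t in F n) (t `^ (z - 1))%:E =
    (u `^ z / z - (u / n.+2%:R) `^ z / z)%:E)%E.
  have un0 : 0 < u / n.+2%:R by rewrite divr_gt0.
  have dF (x : R) : 0 < x -> is_derive x (1:R) (fun t => z^-1 * t `^ z) (x `^ (z - 1)).
    move=> x0; have ? := is_derive1_powR z x0.
    by apply: is_derive_eq; rewrite /GRing.scale/=; field; rewrite gt_eqF.
  have cF (x : R) : 0 < x -> {for x, continuous (fun t => z^-1 * t `^ z)}.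
    move=> x0; apply: differentiable_continuous.
    by apply/derivable1_diffP; have [] := dF x x0.
  rewrite (@continuous_FTC2 _ _ (fun t => z^-1 * t `^ z)).
  - by rewrite -EFinB ![z^-1 * _]mulrC.
  - by rewrite ltr_pdivrMr// ltr_pMr// ltr1n.
  - apply: (@continuous_in_subspaceT R^o) => x; rewrite inE/= in_itv/= => /andP[ux _].
    have x0 : 0 < x := lt_le_trans un0 ux.
    apply: differentiable_continuous; apply/derivable1_diffP.
    by have [] := is_derive1_powR (z - 1) x0.
  - split.
    + move=> x; rewrite in_itv/= => /andP[ux _].
      by have [] := dF x (lt_trans un0 ux).
    + by apply: cvg_at_right_filter; exact: cF.
    + by apply: cvg_at_left_filter; exact: cF.
  - move=> x; rewrite in_itv/= => /andP[ux _].
    by rewrite derive1E; have [] := dF x (lt_trans un0 ux).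
rewrite (funext IE).
apply: cvg_EFin; first by near=> n.
rewrite -[X in _ --> X]subr0; apply: cvgB; first exact: cvg_cst.
rewrite -(mul0r z^-1); apply: cvgM; last exact: cvg_cst.
apply: (@cvg_comp _ _ _ (fun n : nat => u / n.+2%:R) (fun t => t `^ z) _ (0^'+)).
  move=> A [e /= e0 eA]; exists (Num.bound (u / e)) => // n /= ne.
  have un0 : 0 < u / n.+2%:R by rewrite divr_gt0.
  apply: eA => //=; rewrite /ball/= sub0r normrN gtr0_norm//.
  rewrite ltr_pdivrMr// mulrC -ltr_pdivrMr//.
  apply: (lt_le_trans (archi_boundP _)); first by rewrite divr_ge0// ltW.
  by rewrite ler_nat (leq_trans ne)// -addn2 leq_addr.
exact: powR_cvg0.
Unshelve. all: by end_near.
Qed.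

(** Tonelli replaces integration by parts: y^(z-1) e^(-cx) is integrated over 0 < y < x in both
    orders. The inner integrals are x^z e^(-cx) / z and y^(z-1) e^(-cy) / c. No finiteness is
    presupposed, so the recurrence can serve to prove it. *)
Lemma gamma_mass_rec z c : 0 < z -> 0 < c ->
  gamma_mass (z + 1) c = ((z / c)%:E * gamma_mass z c)%E.
Proof.
move=> z0 c0.
pose f (p : R * R) : R := if 0 < p.2 then if 0 < p.1 - p.2 then
  p.2 `^ (z - 1) * expR (- (c * p.1)) else 0 else 0.
have f0 p : (0 <= (f p)%:E)%E.
  rewrite lee_fin /f; case: ifP => // _; case: ifP => // _.
  by rewrite mulr_ge0 ?powR_ge0 ?expR_ge0.
have mf : measurable_fun setT (fun p => (f p)%:E).
  apply/measurable_EFinP; apply: measurable_fun_ifpos; last by mfun.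
  by apply: measurable_fun_ifpos; mfun.
have := @fubini_tonelli _ _ _ _ _ mu mu _ mf f0.
have -> : (\int[mu]_x \int[mu]_y (f (x, y))%:E =
    z^-1%:E * gamma_mass (z + 1) c)%E.
  rewrite /gamma_mass -ge0_integralZl//; last 3 first.
  - exact/measurable_EFinP/measurable_gamma_density.
  - by move=> x _; rewrite lee_fin gamma_density_ge0.
  - by rewrite lee_fin invr_ge0 ltW.
  apply: eq_integral => x _.
  rewrite /gamma_density addrK; case: ifPn => [x0|]; last first.
    rewrite -leNgt => x0; rewrite mule0 integral0_eq// => y _; rewrite /f/= subr_gt0.
    by case: ltP => // y0; case: ltP => // /(lt_trans y0)/lt_le_trans/(_ x0); rewrite ltxx.
  rewrite -EFinM mulrA [z^-1 * _]mulrC.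
  rewrite EFinM -integral_powR_itv// -ge0_integralZr//; try solve [by apply: measurable_funTS; mfun | by move=> t _; rewrite lee_fin powR_ge0 | by rewrite lee_fin expR_ge0].
  rewrite [RHS]integral_mkcond; apply: eq_integral => y _.
  rewrite patchE mem_setE in_itv/= /f/= subr_gt0; case: ifP => //= _.
  by case: ifP.
have -> : (\int[mu]_y \int[mu]_x (f (x, y))%:E =
    c^-1%:E * gamma_mass z c)%E.
  rewrite /gamma_mass -ge0_integralZl//; last 3 first.
  - exact/measurable_EFinP/measurable_gamma_density.
  - by move=> x _; rewrite lee_fin gamma_density_ge0.
  - by rewrite lee_fin invr_ge0 ltW.
  apply: eq_integral => y _.
  rewrite /gamma_density; case: ifPn => [y0|y0]; last first.
    by rewrite mule0 integral0_eq// => x _; rewrite /f/= (negbTE y0).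
  rewrite -EFinM mulrCA EFinM [c^-1 * _]mulrC -integral_expR_tail//.
 rewrite -ge0_integralZl//; try solve [by apply: measurable_funTS; mfun | by move=> t _; rewrite lee_fin powR_ge0 | by rewrite lee_fin expR_ge0 | by move=> t _; rewrite lee_fin expR_ge0 | by rewrite lee_fin powR_ge0].
  rewrite -integral_itv_obnd_cbnd; last first.
    by apply: measurable_funTS; apply: emeasurable_funM; mfun.
  rewrite [RHS]integral_mkcond; apply: eq_integral => x _.
  by rewrite patchE mem_setE in_itv/= andbT /f/= subr_gt0 y0; case: ifP.
move=> E; have := congr1 (fun e => z%:E * e)%E E.
by rewrite !muleA -!EFinM divff ?gt_eqF// mul1e.
Qed.


Lemma gamma_mass1 c : 0 < c -> gamma_mass 1 c = (c^-1)%:E.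
Proof.
move=> c0.
rewrite -[c^-1]mul1r -[X in X / c]expR0 -oppr0 -(mulr0 c) -integral_expR_tail//.
rewrite -integral_itv_obnd_cbnd; last by apply: measurable_funTS; mfun.
rewrite [RHS]integral_mkcond; apply: eq_integral => x _.
rewrite patchE mem_setE in_itv/= andbT /gamma_density; case: ifP => //= _.
by rewrite subrr powRr0 mul1r.
Qed.

Lemma gamma_mass_nat_lty c n : 0 < c -> (gamma_mass n.+1%:R c < +oo)%E.
Proof.
move=> c0; elim: n => [|n IH]; first by rewrite gamma_mass1// ltry.
by rewrite -addn1 natrD gamma_mass_rec// lte_mul_pinfty// lee_fin divr_ge0// ltW.
Qed.

(** By the recurrence it is enough to treat z + 1, where the singularity at 0 is gone: for an
    integer n > z one has t^z <= 1 + t^n, and integer shapes are reached by induction from the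
    exponential law. *)
Lemma gamma_mass_lty z c : 0 < z -> 0 < c -> (gamma_mass z c < +oo)%E.
Proof.
move=> z0 c0.
suff : (gamma_mass (z + 1) c < +oo)%E.
  rewrite gamma_mass_rec// !ltey; apply: contraNN => /eqP ->.
  by rewrite gt0_muley// lte_fin divr_gt0.
have zn := archi_boundP (ltW z0).
set n := Num.bound z in zn.
apply: (@le_lt_trans _ _ (gamma_mass 1 c + gamma_mass n.+1%:R c)%E).
  rewrite /gamma_mass -ge0_integralD//; try solve
    [by move=> x _; rewrite lee_fin gamma_density_ge0
    |exact/measurable_EFinP/measurable_gamma_density].
  apply: ge0_le_integral => //; try solve
    [by move=> x _; rewrite lee_fin gamma_density_ge0
    |exact/measurable_EFinP/measurable_gamma_density
    |apply: emeasurable_funD; exact/measurable_EFinP/measurable_gamma_density].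
  move=> x _; rewrite -EFinD lee_fin /gamma_density; case: ifP => x0; last by rewrite addr0.
  rewrite -mulrDl ler_wpM2r ?expR_ge0// addrK subrr powRr0 -addn1 natrD addrK.
  have [x1|x1] := leP x 1.
    rewrite (@le_trans _ _ 1)// ?lerDl ?powR_ge0//.
    have := ge0_ler_powR (ltW z0) (_ : x \is Num.nneg) (_ : 1 \is Num.nneg) x1.
    by rewrite powR1; apply; rewrite nnegrE// ltW.
  rewrite (@le_trans _ _ (x `^ n%:R))// ?lerDr// ler_powR// ltW//.
apply: lte_add_pinfty; first by rewrite gamma_mass1// ltry.
exact: gamma_mass_nat_lty.
Qed.

(** A zero integral would make the density vanish almost everywhere, although it is positive on the
    whole of ]0, 1[. *)
Lemma gamma_mass_gt0 z c : (0 < gamma_mass z c)%E.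
Proof.
rewrite lt_neqAle gamma_mass_ge0 andbT eq_sym; apply/eqP => E.
have N : mu.-negligible `]0, 1[%classic.
  have mg : measurable_fun setT (fun t => (gamma_density z c t)%:E).
    exact/measurable_EFinP/measurable_gamma_density.
  have : (\int[mu]_t `|(gamma_density z c t)%:E| = 0)%E.
    rewrite -E; apply: eq_integral => t _.
    by rewrite gee0_abs// lee_fin gamma_density_ge0.
  move/(ae_eq_integral_abs mu measurableT mg).
  apply: negligibleS => t /=; rewrite in_itv/= => /andP[t0 t1] /(_ I)/eqP.
  rewrite eqe /gamma_density t0 mulf_eq0 powR_eq0 (gt_eqF t0)/=.
  by rewrite gt_eqF// expR_gt0.
have : mu (`]0, 1[%classic : set R) = 0%E.
  by apply/negligibleP => //; exact: measurable_itv.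
rewrite lebesgue_measure_itv/= lte01 oppr0 adde0.
by move=> /eqP; rewrite onee_eq0.
Qed.

(** [Gamma] is a real-valued integral, which would be 0 if the integral were infinite; finiteness is
    needed as much as positivity. *)
Lemma Gamma_gt0 z : 0 < z -> 0 < Gamma z.
Proof.
move=> z0; rewrite /Gamma /Rintegral.
rewrite (_ : (\int[_]_(_ in _) _)%E = gamma_mass z 1).
  by rewrite fine_gt0// gamma_mass_gt0 gamma_mass_lty.
rewrite integral_mkcond; apply: eq_integral => x _.
by rewrite patchE mem_setE in_itv/= andbT /gamma_density mul1r; case: ifP.
Qed.

End gamma_density.

Ltac mfun_hook ::= lazymatch goal with
  | |- measurable_fun _ (fun x => gamma_density ?z ?c (@?f x)) =>
      refine (@measurable_gamma_density _ _ _ z c f _)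
  end.

(** * Second moments of normal laws on the line *)

Section gauss.
Context {R : realType}.
Local Notation mu := (@lebesgue_measure R).
Implicit Types (p m t w : R).

(* The density of N(m, 1/p): products of normal densities are easiest to
   handle through the precision p. *)
Definition gauss p m t : R :=
  Num.sqrt (p / (2 * pi)) * expR (- (p * (t - m) ^+ 2 / 2)).

Lemma gauss_ge0 p m t : 0 <= gauss p m t.
Proof. by rewrite mulr_ge0 ?sqrtr_ge0 ?expR_ge0. Qed.

Lemma measurable_gauss d (T : measurableType d) (f g h : T -> R) :
  measurable_fun setT f -> measurable_fun setT g -> measurable_fun setT h ->
  measurable_fun setT (fun x => gauss (f x) (g x) (h x)).
Proof. by move=> mf mg mh; rewrite /gauss; mfun. Qed.

Lemma gauss_normal_pdf p m : 0 < p ->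
  gauss p m = normal_pdf m (Num.sqrt p^-1).
Proof.
move=> p0; have s0 : Num.sqrt p^-1 != 0 by rewrite gt_eqF// sqrtr_gt0 invr_gt0.
rewrite normal_pdfE//; apply/funext => t.
rewrite /gauss /normal_peak /normal_fun sqr_sqrtr ?invr_ge0 ?ltW//.
congr (_ * expR _); last by field; rewrite gt_eqF.
rewrite -sqrtrV; last by rewrite -mulr_natl !mulr_ge0 ?invr_ge0 ?pi_ge0 ?ltW.
have [pn0 pi0] : p != 0 /\ (pi : R) != 0 by rewrite !gt_eqF ?pi_gt0.
by move: (pi : R) pi0 => q q0; congr Num.sqrt; field; rewrite pn0 q0.
Qed.

Lemma integral_gauss p m : 0 < p -> (\int[mu]_t (gauss p m t)%:E = 1)%E.
Proof. by move=> p0; rewrite gauss_normal_pdf// integral_normal_pdf. Qed.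

(** Its value is 1, but it is kept as an unknown constant: it will only multiply terms that are free
    of y~. *)
Definition gauss_variance : R := fine (\int[mu]_t (gauss 1 0 t * t ^+ 2)%:E).

Let measurable_gauss_sqr p m (h e : R) :
  measurable_fun setT (fun t : R => (gauss p m t * (h * t + e) ^+ 2)%:E).
Proof.
apply/measurable_EFinP; apply: measurable_funM; last by mfun.
by apply: measurable_gauss; mfun.
Qed.

Let gauss_sqr_ge0 p m h e t : (0 <= (gauss p m t * (h * t + e) ^+ 2)%:E)%E.
Proof. by rewrite lee_fin mulr_ge0 ?gauss_ge0 ?sqr_ge0. Qed.

Lemma gauss_varianceE :
  (\int[mu]_t (gauss 1 0 t * t ^+ 2)%:E = gauss_variance%:E)%E.
Proof.
rewrite /gauss_variance fineK// ge0_fin_numE; last first.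
  by apply: integral_ge0 => t _; rewrite lee_fin mulr_ge0 ?gauss_ge0 ?sqr_ge0.
have mg p m : measurable_fun setT (fun t : R => (gauss p m t)%:E).
  by apply/measurable_EFinP; apply: measurable_gauss.
(* Since 1 + u <= e^u at u = t^2 / 4, half of the exponent absorbs the square: t^2 e^(-t^2/2) <= 4
   e^(-t^2/4). The factor sqrt 2 adjusts the normalisation to precision 1/2. *)
apply: (@le_lt_trans _ _ (\int[mu]_t ((4 * Num.sqrt 2)%:E * (gauss 2^-1 0 t)%:E))%E).
  apply: ge0_le_integral => //.
  - by move=> t _; rewrite lee_fin mulr_ge0 ?gauss_ge0 ?sqr_ge0.
  - apply: (eq_measurable_fun _ _ (measurable_gauss_sqr 1 0 1 0)) => t _.
    by rewrite mul1r addr0.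
  - by apply: measurable_funeM; exact: mg.
  - move=> t _; rewrite -EFinM lee_fin /gauss subr0 mul1r.
    have -> : Num.sqrt (2 * pi)^-1 = Num.sqrt 2 * Num.sqrt (2^-1 / (2 * pi)) :> R.
      have pi0 : (pi : R) != 0 by rewrite gt_eqF ?pi_gt0.
      rewrite -sqrtrM//; congr Num.sqrt.
      by move: (pi : R) pi0 => q q0; field; rewrite q0.
    set s2 := Num.sqrt 2; set s := Num.sqrt (2^-1 / _).
    rewrite [leRHS](_ : _ = s2 * s * (4 * expR (- (2^-1 * t ^+ 2 / 2)))); last by ring.
    rewrite -[leLHS]mulrA ler_wpM2l ?mulr_ge0 ?sqrtr_ge0//.
    rewrite [X in expR X * _](_ : _ = - (2^-1 * t ^+ 2 / 2) - t ^+ 2 / 4); last by field.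
    rewrite expRD -mulrA [leRHS]mulrC ler_wpM2l ?expR_ge0//.
    rewrite expRN ler_pdivrMl ?expR_gt0//.
    have := expR_ge1Dx (t ^+ 2 / 4); nra.
rewrite ge0_integralZl//; try solve [by move=> t _; rewrite lee_fin gauss_ge0
  | by rewrite lee_fin mulr_ge0 ?sqrtr_ge0 | exact: mg].
by rewrite integral_gauss ?invr_gt0// mule1 ltry.
Qed.

(* Adding the integral and its image under t -> - t removes the linear term. *)
Lemma integral_gauss_std_sqr (h e : R) :
  (\int[mu]_t (gauss 1 0 t * (h * t + e) ^+ 2)%:E =
   (h ^+ 2 * gauss_variance + e ^+ 2)%:E)%E.
Proof.
set I := (LHS).
have I0 : (0 <= I)%E by exact: integral_ge0.
have EI : (I + I = (2 * (h ^+ 2 * gauss_variance + e ^+ 2))%:E)%E.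
  have {2}-> : (I = \int[mu]_t (gauss 1 0 t * (h * - t + e) ^+ 2)%:E)%E.
    rewrite /I (@ge0_integral_affine _ (-1) 0 (fun t => (gauss 1 0 t * (h * t + e) ^+ 2)%:E))//.
    rewrite normrN normr1 mul1e; apply: eq_integral => t _.
    by rewrite mulN1r addr0 /gauss !subr0 sqrrN.
  rewrite /I -ge0_integralD//; try solve [
    by move=> t _; rewrite lee_fin mulr_ge0 ?gauss_ge0 ?sqr_ge0
    | exact: measurable_gauss_sqr
    | apply: (eq_measurable_fun _ _ (measurable_gauss_sqr 1 0 (- h) e)) => t _;
      by rewrite mulrN mulNr].
  transitivity (\int[mu]_t ((2 * h ^+ 2)%:E * (gauss 1 0 t * t ^+ 2)%:E +
      (2 * e ^+ 2)%:E * (gauss 1 0 t)%:E))%E.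
    by apply: eq_integral => t _; rewrite -!EFinM -!EFinD; congr EFin; ring.
  have m1 : measurable_fun setT (fun t : R => (gauss 1 0 t * t ^+ 2)%:E).
    apply: (eq_measurable_fun _ _ (measurable_gauss_sqr 1 0 1 0)) => t _.
    by rewrite mul1r addr0.
  have m2 : measurable_fun setT (fun t : R => (gauss 1 0 t)%:E).
    by apply/measurable_EFinP; apply: measurable_gauss.
  have p1 t : (0 <= (gauss 1 0 t * t ^+ 2)%:E)%E.
    by rewrite lee_fin mulr_ge0 ?gauss_ge0 ?sqr_ge0.
  have p2 t : (0 <= (gauss 1 0 t)%:E)%E by rewrite lee_fin gauss_ge0.
  have q1 : (0 <= (2 * h ^+ 2)%:E)%E by rewrite lee_fin mulr_ge0 ?sqr_ge0.
  have q2 : (0 <= (2 * e ^+ 2)%:E)%E by rewrite lee_fin mulr_ge0 ?sqr_ge0.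
  rewrite ge0_integralD//; try solve [by move=> t _; exact: mule_ge0
    | exact: measurable_funeM].
  rewrite !ge0_integralZl// gauss_varianceE integral_gauss// mule1 -EFinM -EFinD.
  by congr EFin; ring.
have If : I \is a fin_num.
  by rewrite ge0_fin_numE// (@le_lt_trans _ _ (I + I)%E) ?leeDl// EI ltry.
move: EI; rewrite -(fineK If) -EFinD => -[EI]; congr EFin; lra.
Qed.

Lemma integral_gauss_sqr p m w : 0 < p ->
  (\int[mu]_t (gauss p m t * (t - w) ^+ 2)%:E =
   (gauss_variance / p + (m - w) ^+ 2)%:E)%E.
Proof.
move=> p0; set h := Num.sqrt p^-1.
have h0 : 0 < h by rewrite sqrtr_gt0 invr_gt0.
have h2 : h ^+ 2 = p^-1 by rewrite sqr_sqrtr// invr_ge0 ltW.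
rewrite (@ge0_integral_affine _ h m (fun t => (gauss p m t * (t - w) ^+ 2)%:E)); last first.
- by move=> t; rewrite lee_fin mulr_ge0 ?gauss_ge0 ?sqr_ge0.
- apply: (eq_measurable_fun _ _ (measurable_gauss_sqr p m 1 (- w))) => t _.
  by rewrite mul1r.
- by rewrite gt_eqF.
rewrite gtr0_norm// -ge0_integralZl//; try solve [
  by move=> t _; rewrite lee_fin mulr_ge0 ?gauss_ge0 ?sqr_ge0 | by rewrite lee_fin ltW
  | by apply/measurable_EFinP; apply: measurable_funM; [apply: measurable_gauss; mfun | mfun]].
rewrite (_ : gauss_variance / p = h ^+ 2 * gauss_variance); last by rewrite h2 mulrC.
rewrite -integral_gauss_std_sqr; apply: eq_integral => t _.
rewrite -EFinM mulrA -addrA; congr (EFin (_ * _)).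
rewrite /gauss mulrA addrK subr0 exprMn h2; congr (_ * expR (- _)); last first.
  by field; rewrite gt_eqF.
rewrite -sqrtrM ?invr_ge0 ?ltW//; congr Num.sqrt.
have [pn0 pi0] : p != 0 /\ (pi : R) != 0 by rewrite !gt_eqF ?pi_gt0.
by move: (pi : R) pi0 => q q0; field; rewrite pn0 q0.
Qed.

End gauss.

Ltac mfun_hook ::= lazymatch goal with
  | |- measurable_fun _ (fun x => gamma_density ?z ?c (@?f x)) =>
      refine (@measurable_gamma_density _ _ _ z c f _)
  | |- measurable_fun _ (fun x => gauss (@?f x) (@?g x) (@?h x)) =>
      refine (@measurable_gauss _ _ _ f g h _ _ _)
  end.

(** * Integrals of product functions over R^n *)

Section lebesgue_tuple_integral.
Context {R : realType}.
Local Notation RT := (measurableTypeR R).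

Lemma ge0_integral_lebesgue_tupleS n (f : n.+1.-tuple RT -> \bar R) :
  measurable_fun setT f -> (forall t, 0 <= f t)%E ->
  (\int[lebesgue_tuple n.+1]_t f t =
   \int[lebesgue_measure]_x \int[lebesgue_tuple n]_t f (consp (x, t)))%E.
Proof.
move=> mf f0.
have mc : measurable_fun setT (f \o @consp R n).
  by apply: measurableT_comp => //; exact: measurable_consp.
rewrite -(@fubini_tonelli1 _ _ _ _ _ lebesgue_measure (lebesgue_tuple n)
  (f \o @consp R n))//=.
exact: (@ge0_integral_pushforward _ _ _ _ _ _ (@measurable_consp R n)).
Qed.

Lemma measurable_fun_tnth n (F : 'I_n -> R -> R) :
  (forall i, measurable_fun setT (F i)) ->
  measurable_fun setT (fun t : n.-tuple RT => \prod_(i < n) F i (tnth t i)).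
Proof.
move=> mF.
have := @measurable_prod _ (n.-tuple RT) R setT 'I_n (index_enum 'I_n)
  (fun i t => F i (tnth t i)); apply => i _.
exact: (measurableT_comp (mF i) (@measurable_tnth _ RT n i)).
Qed.

Lemma integral_prod_tnth n (F : 'I_n -> R -> R) (a : 'I_n -> R) :
  (forall i, measurable_fun setT (F i)) -> (forall i t, 0 <= F i t) ->
  (forall i, \int[lebesgue_measure]_t (F i t)%:E = (a i)%:E)%E ->
  (\int[lebesgue_tuple n]_t (\prod_(i < n) F i (tnth t i))%:E =
   (\prod_(i < n) a i)%:E)%E.
Proof.
elim: n F a => [|n IH] F a mF F0 Fa.
  rewrite big_ord0 (eq_integral (cst 1%E)); last by move=> t _; rewrite big_ord0.
  by rewrite integral_cst//= diracT mule1.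
rewrite ge0_integral_lebesgue_tupleS; last 2 first.
- by apply/measurable_EFinP; exact: (measurable_fun_tnth mF).
- by move=> t; rewrite lee_fin prodr_ge0.
have a0 i : 0 <= a i by rewrite -lee_fin -Fa integral_ge0// => t _; rewrite lee_fin.
rewrite big_ord_recl [RHS]EFinM -Fa -ge0_integralZr//; last first.
- by rewrite lee_fin prodr_ge0.
- by move=> t _; rewrite lee_fin.
- by apply/measurable_EFinP; exact: mF.
apply: eq_integral => x _.
rewrite -(IH (fun i => F (lift ord0 i)))//.
rewrite -ge0_integralZl//; try solve [apply/measurable_EFinP; exact: (measurable_fun_tnth (fun i => mF (lift ord0 i)))
  | by move=> t _; rewrite lee_fin prodr_ge0 | by rewrite lee_fin].
apply: eq_integral => t _; rewrite -EFinM big_ord_recl; congr (EFin (_ * _)).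
by apply: eq_bigr => i _; rewrite tnthS.
Qed.

End lebesgue_tuple_integral.

(** * Normal densities with diagonal covariance as products *)

Section mvn_diag.
Context {R : realType}.

Lemma quad_diag_mx n (e : 'rV[R]_n) (u : 'cV[R]_n) :
  (u^T *m diag_mx e *m u) ord0 ord0 = \sum_i e ord0 i * u i ord0 ^+ 2.
Proof.
rewrite mul_mx_diag mxE; apply: eq_bigr => i _.
by rewrite !mxE mulrAC -expr2 mulrC.
Qed.

Lemma invmx_diag n (e : 'rV[R]_n) : (forall i, e ord0 i != 0) ->
  invmx (diag_mx e) = diag_mx (\row_i (e ord0 i)^-1).
Proof.
move=> e0; have E1 : diag_mx e *m diag_mx (\row_i (e ord0 i)^-1) = 1%:M.
  rewrite mul_diag_mx; apply/matrixP => i j; rewrite !mxE.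
  by case: eqVneq => [->|_]; rewrite ?mulr1n ?mulr0n ?mulr0// divff.
have [U _] := mulmx1_unit E1.
by rewrite -[LHS]mulmx1 -E1 mulmxA mulVmx// mul1mx.
Qed.

Lemma mvn_pdf_diag n (mean x : 'cV[R]_n) (e : 'rV[R]_n) :
  (forall i, 0 < e ord0 i) ->
  mvn_pdf mean (diag_mx e) x =
  \prod_i gauss (e ord0 i)^-1 (mean i ord0) (x i ord0).
Proof.
move=> e0; rewrite /mvn_pdf -linearZ det_diag invmx_diag; last first.
  by move=> i; rewrite gt_eqF.
rewrite quad_diag_mx /gauss big_split/=; congr (_ * _).
  rewrite [RHS](eq_bigr (fun i => (Num.sqrt ((2 * pi) * e ord0 i))^-1)); last first.
    move=> i _; rewrite -sqrtrV ?mulr_ge0 ?pi_ge0 ?ltW//.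
    by congr Num.sqrt; rewrite [RHS]invfM [RHS]mulrC.
  rewrite prodfV; congr _^-1.
  rewrite (eq_bigr (fun i => (2 * pi) * e ord0 i)); last by move=> i _; rewrite !mxE.
  elim/big_rec2 : _ => [|i y1 y2 _ <-]; first by rewrite sqrtr1.
  by rewrite sqrtrM// !mulr_ge0 ?pi_ge0 ?ltW.
rewrite -expR_sum; congr expR.
rewrite mulNr mulr_suml -sumrN; apply: eq_bigr => i _.
by rewrite !mxE.
Qed.

Lemma mvn_pdf_scalar n (mean x : 'cV[R]_n) (e : R) : 0 < e ->
  mvn_pdf mean e%:M x = \prod_i gauss e^-1 (mean i ord0) (x i ord0).
Proof.
move=> e0; rewrite -diag_const_mx mvn_pdf_diag; last by move=> i; rewrite mxE.
by apply: eq_bigr => i _; rewrite mxE.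
Qed.

Lemma mvn_pdf_scale_diag n (mean x : 'cV[R]_n) (a : R) (e : 'rV[R]_n) :
  0 < a -> (forall i, 0 < e ord0 i) ->
  mvn_pdf mean (a *: diag_mx e) x =
  \prod_i gauss (a * e ord0 i)^-1 (mean i ord0) (x i ord0).
Proof.
move=> a0 e0; rewrite -linearZ mvn_pdf_diag; last by move=> i; rewrite mxE mulr_gt0.
by apply: eq_bigr => i _; rewrite mxE.
Qed.

End mvn_diag.

(** * From (eta, lam) to the pair (x, y) on the open quadrant *)

Section quadrant.
Context {R : realType}.
Local Notation mu := (@lebesgue_measure R).
Local Open Scope ereal_scope.

(* The change of variables (eta, lam) |-> (lam eta, (1 - lam) eta), done one
   coordinate at a time. *)
Lemma ge0_integral_quadrant (f : R * R -> \bar R) :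
  measurable_fun setT f -> (forall p, 0 <= f p) ->
  (forall x y, ~~ ((0 < x) && (0 < y))%R -> f (x, y) = 0) ->
  \int[mu]_eta \int[mu]_lam (eta%:E * f (lam * eta, (1 - lam) * eta)%R) =
  \int[mu]_x \int[mu]_y f (x, y).
Proof.
move=> mf f0 fS.
have mfsub : measurable_fun setT (fun p : R * R => f (p.2, p.1 - p.2)%R).
  by apply: measurableT_comp => //; apply: measurable_fun_pair; mfun.
transitivity (\int[mu]_eta \int[mu]_x f (x, eta - x)%R).
  (* The two arguments of [f] add up to eta, so for eta <= 0 they cannot both be positive and both
     sides vanish. *)
  apply: eq_integral => eta _; have [eta0|eta0] := ltP 0%R eta; last first.
    rewrite !integral0_eq// => x _; rewrite fS ?mule0//;
      apply/negP => /andP[x0 y0]; have := addr_gt0 x0 y0.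
    - by rewrite addrC subrK ltNge eta0.
    - by rewrite -mulrDl addrC subrK mul1r ltNge eta0.
  have m1 : measurable_fun setT (fun x : R => f (x, eta - x)%R).
    by apply: measurableT_comp => //; apply: measurable_fun_pair; mfun.
  rewrite (@ge0_integral_affine _ eta 0 (fun x => f (x, eta - x)%R))//; last first.
    by rewrite gt_eqF.
  rewrite gtr0_norm// -ge0_integralZl//; last 2 first.
  - apply: measurableT_comp => //; apply: measurable_fun_pair; mfun.
  - by rewrite lee_fin ltW.
  apply: eq_integral => lam _; congr (_ * f (_, _)).
    by rewrite addr0 mulrC.
  by rewrite addr0; ring.
rewrite (@fubini_tonelli _ _ _ _ _ mu mu (fun p : R * R => f (p.2, p.1 - p.2)%R) mfsub)//.
apply: eq_integral => x _.
have m2 : measurable_fun setT (fun y : R => f (x, y)).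
  by apply: measurableT_comp => //; apply: measurable_fun_pair; mfun.
rewrite (@ge0_integral_affine _ 1 (- x) (fun y => f (x, y)))//.
rewrite normr1 mul1e; apply: eq_integral => y _.
by rewrite mul1r.
Qed.

End quadrant.

(** * Normal conjugacy given eta and lambda *)

Section conjugacy.
Context {R : realType}.
Local Notation RT := (measurableTypeR R).

(** Bayes' rule in one coordinate: likelihood times prior is marginal times posterior. The prior
    variance is such that d + d (c / lam - 1) = d c / lam, so the marginal variance of v depends on
    the parameters only through lam eta. This is where the variable x = lam eta comes from. *)
Lemma gauss_conjugate (eta lam c d v t : R) :
  0 < eta -> 0 < lam < 1 -> 1 <= c -> 0 < d ->
  gauss (eta^-1 * d)^-1 t v * gauss (eta^-1 * (d * (lam^-1 * c - 1)))^-1 0 t =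
  gauss (lam * eta / (d * c)) 0 v *
  gauss (eta * c / (d * (c - lam))) ((1 - lam / c) * v) t.
Proof.
move=> eta0 /andP[lam0 lam1] c1 d0.
have c0 : 0 < c by rewrite (lt_le_trans ltr01).
have cl : 0 < c - lam by rewrite subr_gt0 (lt_le_trans lam1).
have pi0 : (0 : R) < pi := pi_gt0 R.
have cE : lam^-1 * c - 1 = (c - lam) / lam by field; rewrite gt_eqF.
rewrite /gauss !subr0 mulrACA [in RHS]mulrACA -!expRD -!sqrtrM; last 2 first.
- by rewrite !(mulr_ge0, invr_ge0) ?ltW.
- by rewrite !(mulr_ge0, invr_ge0) ?ltW.
rewrite cE; congr (Num.sqrt _ * expR _).
- move: (pi : R) pi0 => w w0; field.
  by rewrite !gt_eqF.
- by field; rewrite !gt_eqF.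
Qed.

(** The conditional posterior density of theta given (eta, lam); with c constantly gamma and d
    constantly 1 it is that of mu. *)
Definition cond_pdf n (c d : 'rV[R]_n) (v : 'cV[R]_n) (eta lam : R)
    (t : n.-tuple RT) : R :=
  \prod_i gauss (eta * c ord0 i / (d ord0 i * (c ord0 i - lam)))
    ((1 - lam / c ord0 i) * v i ord0) (tnth t i).

(** With [marg_quad], the parameter-free ingredients of the marginal law of v, which has independent
    coordinates N(0, d_i c_i / x). *)
Definition marg_const n (c d : 'rV[R]_n) : R :=
  \prod_i Num.sqrt (2 * pi * (d ord0 i * c ord0 i))^-1.

Definition marg_quad n (c d : 'rV[R]_n) (v : 'cV[R]_n) : R :=
  \sum_i v i ord0 ^+ 2 / (d ord0 i * c ord0 i).

Lemma cond_pdf_ge0 n c d v eta lam t : 0 <= @cond_pdf n c d v eta lam t.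
Proof. by apply: prodr_ge0 => i _; exact: gauss_ge0. Qed.

Lemma marg_const_gt0 n (c d : 'rV[R]_n) :
  (forall i, 1 <= c ord0 i) -> (forall i, 0 < d ord0 i) -> 0 < marg_const c d.
Proof.
move=> c1 d0; apply: prodr_gt0 => i _.
by rewrite sqrtr_gt0 invr_gt0 !mulr_gt0 ?pi_gt0// (lt_le_trans ltr01).
Qed.

Lemma marg_quad_ge0 n (c d : 'rV[R]_n) v :
  (forall i, 1 <= c ord0 i) -> (forall i, 0 < d ord0 i) -> 0 <= marg_quad c d v.
Proof.
move=> c1 d0; apply: sumr_ge0 => i _; rewrite divr_ge0 ?sqr_ge0// mulr_ge0//.
  exact: ltW.
by rewrite (le_trans ler01).
Qed.

Lemma prod_gauss_marg n (c d : 'rV[R]_n) (v : 'cV[R]_n) (x : R) : 0 <= x ->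
  (forall i, 1 <= c ord0 i) -> (forall i, 0 < d ord0 i) ->
  \prod_i gauss (x / (d ord0 i * c ord0 i)) 0 (v i ord0) =
  x `^ (n%:R / 2) * marg_const c d * expR (- (x * marg_quad c d v / 2)).
Proof.
move=> x0 c1 d0.
rewrite /gauss big_split/=; congr (_ * _).
  have -> : x `^ (n%:R / 2) = \prod_(i < n) Num.sqrt x.
    rewrite prodr_const card_ord mulrC powRrM powR12_sqrt// powR_mulrn//.
  rewrite /marg_const -big_split/=; apply: eq_bigr => i _.
  rewrite -sqrtrM//; congr Num.sqrt; rewrite -mulrA; congr (_ * _).
  by rewrite -invfM mulrC.
rewrite -expR_sum; congr expR; rewrite sumrN; congr (- _).
rewrite /marg_quad mulr_sumr mulr_suml; apply: eq_bigr => i _.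
by rewrite subr0; ring.
Qed.

Lemma mvn_pdf_conjugate n (c d : 'rV[R]_n) (v : 'cV[R]_n) (eta lam : R)
    (t : n.-tuple RT) : 0 < eta -> 0 < lam < 1 ->
  (forall i, 1 <= c ord0 i) -> (forall i, 0 < d ord0 i) ->
  mvn_pdf (colt t) (eta^-1 *: diag_mx d) v *
  mvn_pdf 0 (eta^-1 *: (diag_mx d *m (lam^-1 *: diag_mx c - 1%:M))) (colt t) =
  (lam * eta) `^ (n%:R / 2) * marg_const c d *
    expR (- (lam * eta * marg_quad c d v / 2)) * cond_pdf c d v eta lam t.
Proof.
move=> eta0 lam01 c1 d0; have /andP[lam0 lam1] := lam01.
have -> : diag_mx d *m (lam^-1 *: diag_mx c - 1%:M) =
    diag_mx (\row_i (d ord0 i * (lam^-1 * c ord0 i - 1))).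
  rewrite mul_diag_mx; apply/matrixP => i j; rewrite !mxE.
  by case: eqVneq => [->|_]; rewrite ?mulr1n ?mulr0n// mulr0 subr0 mulr0.
rewrite !mvn_pdf_scale_diag ?invr_gt0//; last first.
  move=> i; rewrite mxE mulr_gt0// subr_gt0 mulrC ltr_pdivlMr// mul1r.
  exact: lt_le_trans (c1 i).
rewrite -prod_gauss_marg//; last by rewrite mulr_ge0// ltW.
rewrite /cond_pdf -!big_split/=; apply: eq_bigr => i _.
by rewrite !mxE -gauss_conjugate.
Qed.

Lemma measurable_cond_pdf d0 (T : measurableType d0) n (c d : 'rV[R]_n)
    (v : 'cV[R]_n) (f g : T -> R) (h : T -> n.-tuple RT) :
  measurable_fun setT f -> measurable_fun setT g -> measurable_fun setT h ->
  measurable_fun setT (fun x => cond_pdf c d v (f x) (g x) (h x)).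
Proof.
move=> mf mg mh; rewrite /cond_pdf.
have := @measurable_prod _ T R setT 'I_n (index_enum 'I_n) (fun i x =>
  gauss (f x * c ord0 i / (d ord0 i * (c ord0 i - g x)))
    ((1 - g x / c ord0 i) * v i ord0) (tnth (h x) i)); apply => i _.
apply: measurable_gauss; last exact: (measurableT_comp (@measurable_tnth _ RT n i) mh).
- by mfun.
- by mfun.
Qed.

Lemma integral_cond_pdf n (c d : 'rV[R]_n) (v : 'cV[R]_n) (eta lam : R) :
  0 < eta -> 0 < lam < 1 -> (forall i, 1 <= c ord0 i) -> (forall i, 0 < d ord0 i) ->
  (\int[lebesgue_tuple n]_t (cond_pdf c d v eta lam t)%:E = 1)%E.
Proof.
move=> eta0 /andP[lam0 lam1] c1 d0.
rewrite (@integral_prod_tnth _ _ (fun i => gauss _ _) (fun=> 1)) ?big1//.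
- by move=> i; apply: measurable_gauss.
- by move=> i t; exact: gauss_ge0.
- move=> i; apply: integral_gauss; rewrite divr_gt0// mulr_gt0// ?subr_gt0.
    by rewrite (lt_le_trans ltr01).
  by rewrite (lt_le_trans lam1).
Qed.

Lemma integral_cond_pdf_sqr n (c d : 'rV[R]_n) (v : 'cV[R]_n) (eta lam : R)
    (j : 'I_n) (w : R) :
  0 < eta -> 0 < lam < 1 -> (forall i, 1 <= c ord0 i) -> (forall i, 0 < d ord0 i) ->
  (\int[lebesgue_tuple n]_t (cond_pdf c d v eta lam t * (tnth t j - w) ^+ 2)%:E =
   (gauss_variance * (d ord0 j * (1 - lam / c ord0 j)) / eta +
    ((1 - lam / c ord0 j) * v j ord0 - w) ^+ 2)%:E)%E.
Proof.
move=> eta0 /andP[lam0 lam1] c1 d0.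
have cl i : 0 < c ord0 i - lam by rewrite subr_gt0 (lt_le_trans lam1).
have c0 i : 0 < c ord0 i by rewrite (lt_le_trans ltr01).
pose p i := eta * c ord0 i / (d ord0 i * (c ord0 i - lam)).
pose m i := (1 - lam / c ord0 i) * v i ord0.
have p0 i : 0 < p i by rewrite divr_gt0// mulr_gt0.
(* The square is attached to the j-th factor, which keeps the integrand a product over coordinates;
   the other factors integrate to 1. *)
pose F i t := gauss (p i) (m i) t * (if i == j then (t - w) ^+ 2 else 1).
pose a i := if i == j then gauss_variance / p i + (m i - w) ^+ 2 else 1.
transitivity (\int[lebesgue_tuple n]_t (\prod_i F i (tnth t i))%:E)%E.
  apply: eq_integral => t _; congr EFin; rewrite /F big_split/=; congr (_ * _).
  by rewrite (bigD1 j)//= eqxx big1 ?mulr1// => i /negPf ->.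
rewrite (@integral_prod_tnth _ _ F a).
- rewrite (bigD1 j)//= big1 ?mulr1; last by move=> i /negPf; rewrite /a => ->.
  rewrite /a eqxx /p /m; congr (EFin (_ + _)); field.
  by rewrite !gt_eqF.
- move=> i; rewrite /F; apply: measurable_funM; first exact: measurable_gauss.
  by case: (i == j); [mfun|].
- by move=> i t; rewrite /F mulr_ge0 ?gauss_ge0//; case: ifP => // _; exact: sqr_ge0.
- move=> i; rewrite /F /a; case: ifP => _; first exact: integral_gauss_sqr.
  by under eq_integral do rewrite mulr1; exact: integral_gauss.
Qed.

End conjugacy.

Ltac mfun_hook ::= lazymatch goal with
  | |- measurable_fun _ (fun x => gamma_density ?z ?c (@?f x)) =>
      refine (@measurable_gamma_density _ _ _ z c f _)
  | |- measurable_fun _ (fun x => gauss (@?f x) (@?g x) (@?h x)) =>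
      refine (@measurable_gauss _ _ _ f g h _ _ _)
  | |- measurable_fun _ (fun x => cond_pdf ?c ?d ?v (@?f x) (@?g x) (@?h x)) =>
      refine (@measurable_cond_pdf _ _ _ _ c d v f g h _ _ _)
  end.

(** * Likelihood times prior in terms of the gamma pair *)

Section joint_density.
Context {R : realType}.
Local Notation RT := (measurableTypeR R).
Local Notation leb := (@lebesgue_measure R).
Variables (l q r : nat) (c d : 'rV[R]_l) (gamma a s : R).
Variables (v : 'cV[R]_l) (vs : 'cV[R]_q).
Local Notation Psi := (l.-tuple RT * q.-tuple RT * RT)%type.
Local Notation Lik := (likelihood r (diag_mx d) v vs s).
Local Notation Prior :=
  (hier_prior (diag_mx d) (diag_mx c) gamma a (r%:R / 2 - 1)).

(* Under the posterior, x = lam * eta and y = (1 - lam) * eta are independent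
   with the gamma densities of shapes [shapeA], [shapeB] and rates [rateA],
   [rateB]. *)
Definition shapeA : R := (l + q)%:R / 2 + a + 1.
Definition shapeB : R := r%:R / 2.
Definition rateA : R :=
  (s + (marg_quad c d v + marg_quad (const_mx gamma) (const_mx 1) vs)) / 2.
Definition rateB : R := s / 2.

Definition joint_const : R :=
  marg_const c d * marg_const (const_mx gamma : 'rV[R]_q) (const_mx 1) *
  (s `^ (shapeB - 1) / (2 `^ shapeB * Gamma shapeB)).

Definition gamma_pair (x y : R) : R :=
  gamma_density shapeA rateA x * gamma_density shapeB rateB y.

(** The factor [psi.2] is the Jacobian of (eta, lam) |-> (lam eta, (1 - lam) eta). Outside eta > 0,
    0 < lam < 1 the gamma densities vanish, so integrals of [joint] need no restriction of the
    domain. *)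
Definition joint (psi : Psi) (lam : R) : R :=
  cond_pdf c d v psi.2 lam psi.1.1 *
  cond_pdf (const_mx gamma) (const_mx 1) vs psi.2 lam psi.1.2 *
  (joint_const * (psi.2 * gamma_pair (lam * psi.2) ((1 - lam) * psi.2))).

Hypothesis r_gt0 : (0 < r)%N.
Hypothesis c_ge1 : forall i, 1 <= c ord0 i.
Hypothesis d_gt0 : forall i, 0 < d ord0 i.
Hypothesis gamma_ge1 : 1 <= gamma.
Hypothesis s_gt0 : 0 < s.

Let cg_ge1 (i : 'I_q) : 1 <= (const_mx gamma : 'rV[R]_q) ord0 i.
Proof. by rewrite mxE. Qed.

Let d1_gt0 (i : 'I_q) : (0 : R) < (const_mx 1 : 'rV[R]_q) ord0 i.
Proof. by rewrite mxE. Qed.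

Lemma shapeB_gt0 : 0 < shapeB.
Proof. by rewrite divr_gt0// ltr0n. Qed.

Lemma joint_const_gt0 : 0 < joint_const.
Proof.
rewrite /joint_const !mulr_gt0 ?marg_const_gt0// ?invr_gt0 ?mulr_gt0 ?powR_gt0//.
exact/Gamma_gt0/shapeB_gt0.
Qed.

Lemma gamma_pair_ge0 x y : 0 <= gamma_pair x y.
Proof. by rewrite mulr_ge0 ?gamma_density_ge0. Qed.

Lemma gamma_pair_eq0 x y : ~~ ((0 < x) && (0 < y)) -> gamma_pair x y = 0.
Proof.
rewrite negb_and /gamma_pair /gamma_density.
by move=> /orP[]/negPf ->; rewrite ?mul0r ?mulr0.
Qed.

Lemma gamma_pair_eq0_mix eta lam : ~~ [&& 0 < eta, 0 < lam & lam < 1] ->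
  gamma_pair (lam * eta) ((1 - lam) * eta) = 0.
Proof.
move=> H; apply: gamma_pair_eq0; apply: contra H => /andP[x0 y0].
have eta0 : 0 < eta by have := addr_gt0 x0 y0; rewrite -mulrDl addrC subrK mul1r.
by move: x0 y0; rewrite eta0 !pmulr_lgt0// subr_gt0 => -> ->.
Qed.

Lemma joint_ge0 psi lam : 0 <= joint psi lam.
Proof.
rewrite /joint; apply: mulr_ge0; first by rewrite mulr_ge0 ?cond_pdf_ge0.
apply: mulr_ge0; first exact: ltW joint_const_gt0.
have [/andP[eta0 _]|H] := boolP [&& 0 < psi.2, 0 < lam & lam < 1].
  by rewrite mulr_ge0 ?gamma_pair_ge0// ltW.
by rewrite gamma_pair_eq0_mix// mulr0.
Qed.

Lemma joint_eq0 psi lam : ~~ [&& 0 < psi.2, 0 < lam & lam < 1] -> joint psi lam = 0.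
Proof. by move=> H; rewrite /joint gamma_pair_eq0_mix// !mulr0. Qed.

Lemma measurable_joint d0 (T : measurableType d0) (f : T -> Psi) (g : T -> R) :
  measurable_fun setT f -> measurable_fun setT g ->
  measurable_fun setT (fun x => joint (f x) (g x)).
Proof. by move=> mf mg; rewrite /joint /gamma_pair; mfun. Qed.

(** The exponents of the prior are made for this. The marginals of v and vs give x^((l+q)/2), and
    the common exponent a of eta and lam gives x^a. The choice b = r/2 - 1 combines (1 - lam)^b with
    the chi-square factor eta^(r/2-1) into y^(r/2-1). The one remaining eta, from the density of S,
    is the Jacobian. *)
Lemma likelihood_prior_joint (psi : Psi) (lam : R) :
  0 < psi.2 -> 0 < lam < 1 ->
  Lik psi *
  (mvn_pdf 0 ((eta_of psi)^-1 *: (diag_mx d *m (lam^-1 *: diag_mx c - 1%:M)))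
     (theta_of psi) *
   mvn_pdf 0 ((eta_of psi)^-1 * (gamma / lam - 1))%:M (mu_of psi) *
   (eta_of psi `^ a * (lam `^ a * (1 - lam) `^ (r%:R / 2 - 1)))) = joint psi lam.
Proof.
case: psi => [[th mu] eta] /= eta0 lam01; have /andP[lam0 lam1] := lam01.
have lam1' : 0 < 1 - lam by rewrite subr_gt0.
rewrite /likelihood /theta_of /mu_of /eta_of /=.
have -> : (eta^-1)%:M = eta^-1 *: diag_mx (const_mx 1 : 'rV[R]_q).
  by rewrite diag_const_mx scale_scalar_mx mulr1.
have -> : (eta^-1 * (gamma / lam - 1))%:M = eta^-1 *: (diag_mx (const_mx 1 : 'rV[R]_q) *m
    (lam^-1 *: diag_mx (const_mx gamma) - 1%:M)).
  by rewrite !diag_const_mx mul1mx !scale_scalar_mx -raddfB scale_scalar_mx mulrC mulrC (mulrC lam^-1).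
set m1 := mvn_pdf (colt th) _ _; set m2 := mvn_pdf (colt mu) _ _.
set m3 := mvn_pdf 0 _ _; set m4 := mvn_pdf 0 _ _; set e1 := eta * _; set e2 := _ `^ a * _.
transitivity ((m1 * m3) * (m2 * m4) * (e1 * e2)); first by ring.
rewrite /m1 /m2 /m3 /m4 !mvn_pdf_conjugate// /joint/=.
set C1 := cond_pdf _ _ _ _ _ _; set C2 := cond_pdf _ _ _ _ _ _.
rewrite /e1 /e2 /chi2_pdf mulr_gt0// -/shapeB /joint_const /gamma_pair /gamma_density.
rewrite !mulr_gt0//.
set M1 := marg_const _ _; set M2 := marg_const _ _.
set q1 := marg_quad _ _ _; set q2 := marg_quad _ _ _.
set w := lam * eta; have w0 : 0 < w by exact: mulr_gt0.
have -> : w `^ (shapeA - 1) = w `^ (l%:R / 2) * w `^ (q%:R / 2) * (lam `^ a * eta `^ a).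
  rewrite -(powRM a (ltW lam0) (ltW eta0)) -!powRD ?(gt_eqF w0) ?implybT//.
  by congr (_ `^ _); rewrite /shapeA natrD; field.
have -> : expR (- (rateA * w)) = expR (- (w * q1 / 2)) * expR (- (w * q2 / 2)) * expR (- (w * s / 2)).
  by rewrite -!expRD; congr expR; rewrite /rateA -/q1 -/q2; field.
(* As eta = x + y, the chi-square exponential is shared by the two gamma densities; its x-part
   already sits in the [rateA] factor. *)
have -> : expR (- (rateB * ((1 - lam) * eta))) = expR (- (eta * s) / 2) * (expR (- (w * s / 2)))^-1.
  by rewrite -expRN -expRD; congr expR; rewrite /rateB /w; field.
rewrite !powRM ?mulr_ge0 ?ltW//.
have := expR_gt0 (- (w * s / 2)); set E3 := expR (- (w * s / 2)) => E30.
have G0 := Gamma_gt0 shapeB_gt0; have P0 : 0 < 2 `^ shapeB :> R by exact: powR_gt0.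
move: (Gamma shapeB) (2 `^ shapeB) G0 P0 => G P G0 P0.
by field; rewrite !gt_eqF.
Qed.

Lemma likelihood_gt0 (psi : Psi) : 0 < psi.2 -> 0 < Lik psi.
Proof.
case: psi => [[th mu] eta] /= eta0; rewrite /likelihood /theta_of /mu_of /eta_of /=.
have g0 (p m t : R) : 0 < p -> 0 < gauss p m t.
  move=> p0; rewrite mulr_gt0 ?expR_gt0// sqrtr_gt0 divr_gt0// mulr_gt0//.
  exact: pi_gt0.
rewrite mvn_pdf_scale_diag ?invr_gt0// mvn_pdf_scalar ?invr_gt0//.
rewrite !mulr_gt0//.
- by apply: prodr_gt0 => i _; apply: g0; rewrite invr_gt0 mulr_gt0// invr_gt0.
- by apply: prodr_gt0 => i _; apply: g0; rewrite invrK.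
- rewrite /chi2_pdf mulr_gt0// !(mulr_gt0, invr_gt0) ?powR_gt0 ?expR_gt0// ?mulr_gt0//.
  exact/Gamma_gt0/shapeB_gt0.
Qed.

(** The prior may be infinite at psi, so the likelihood is not simply moved inside: the prior is
    rewritten as the integral of [joint] divided by the positive likelihood, and a nonnegative
    constant can always be taken out. *)
Lemma likelihood_prior_integral (psi : Psi) : 0 < psi.2 ->
  ((Lik psi)%:E * Prior psi = \int[leb]_lam (joint psi lam)%:E)%E.
Proof.
move=> eta0; have L0 := likelihood_gt0 eta0.
have mj : measurable_fun setT (fun lam => (joint psi lam)%:E).
  by apply/measurable_EFinP; apply: measurable_joint.
have -> : (Prior psi = \int[leb]_lam ((Lik psi)^-1%:E * (joint psi lam)%:E))%E.
  rewrite /hier_prior integral_mkcond; apply: eq_integral => lam _.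
  rewrite patchE mem_setE in_itv/=; case: ifPn => [lam01|lam01].
    by rewrite -likelihood_prior_joint// -EFinM mulKf// gt_eqF.
  by rewrite joint_eq0 ?mule0// eta0.
rewrite ge0_integralZl//; last 2 first.
- by move=> lam _; rewrite lee_fin joint_ge0.
- by rewrite lee_fin invr_ge0 ltW.
by rewrite muleA -EFinM divff ?mul1e// gt_eqF.
Qed.

Lemma measurable_param_space : measurable (param_space R l q).
Proof.
have -> : param_space R l q = snd @^-1` `]0, +oo[.
  by apply/seteqP; split=> psi; rewrite /param_space /eta_of /= in_itv/= andbT.
rewrite -[X in measurable X]setTI; exact: measurable_snd.
Qed.

Lemma measurable_likelihood_prior :
  measurable_fun (param_space R l q) (fun psi => (Lik psi)%:E * Prior psi)%E.
Proof.
apply: (eq_measurable_fun (fun psi => \int[leb]_lam (joint psi lam)%:E)%E).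
  by move=> psi; rewrite inE => eta0; rewrite likelihood_prior_integral.
apply: measurable_funTS.
apply: (@measurable_fun_fubini_tonelli_F _ _ _ _ _ leb
  (fun p : Psi * R => (joint p.1 p.2)%:E)).
- by apply/measurable_EFinP; apply: measurable_joint.
- by move=> p; rewrite lee_fin joint_ge0.
Qed.

Section integration.
Variable g : l.-tuple RT * RT -> R.
Hypothesis mg : measurable_fun setT g.
Hypothesis g0 : forall p, 0 <= g p.

(** The conditional posterior expectation of g(theta, eta) given p = (eta, lam). *)
Definition cond_mean (p : R * R) : \bar R :=
  (\int[lebesgue_tuple l]_t (g (t, p.1) * cond_pdf c d v p.1 p.2 t)%:E)%E.

Lemma cond_mean_ge0 p : (0 <= cond_mean p)%E.
Proof. by apply: integral_ge0 => t _; rewrite lee_fin mulr_ge0 ?cond_pdf_ge0. Qed.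

Lemma measurable_cond_mean : measurable_fun setT cond_mean.
Proof.
apply: (@measurable_fun_fubini_tonelli_F _ _ _ _ _ (lebesgue_tuple l)
  (fun p : (R * R) * l.-tuple RT => (g (p.2, p.1.1) * cond_pdf c d v p.1.1 p.1.2 p.2)%:E)).
- apply/measurable_EFinP; apply: measurable_funM; last by mfun.
  by apply: measurableT_comp => //; apply: measurable_fun_pair; mfun.
- by move=> p; rewrite lee_fin mulr_ge0 ?cond_pdf_ge0.
Qed.

Let P := prod_sfm (lebesgue_tuple l : {sigma_finite_measure set (l.-tuple RT) -> \bar R})
  (lebesgue_tuple q : {sigma_finite_measure set (q.-tuple RT) -> \bar R}).

(** The prior's integral over lam is taken out by Tonelli. For fixed (eta, lam) the mu-density then
    integrates to 1, as g does not see mu, and theta contributes [cond_mean]. The change of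
    variables on the quadrant finishes, with eta = x + y and lam = x / (x + y). *)
Lemma integral_likelihood_prior :
  (\int[param_measure R l q]_(psi in param_space R l q)
     ((g (psi.1.1, psi.2))%:E * ((Lik psi)%:E * Prior psi)) =
   \int[leb]_x \int[leb]_y ((joint_const * gamma_pair x y)%:E *
     cond_mean ((x + y)%R, (x / (x + y))%R)))%E.
Proof.
pose h (p : Psi * R) : R := g (p.1.1.1, p.1.2) * joint p.1 p.2.
have h0 p : (0 <= (h p)%:E)%E by rewrite lee_fin mulr_ge0 ?joint_ge0.
have mh d0 (T : measurableType d0) (f1 : T -> l.-tuple RT) (f2 : T -> q.-tuple RT)
    (f3 f4 : T -> R) : measurable_fun setT f1 -> measurable_fun setT f2 ->
    measurable_fun setT f3 -> measurable_fun setT f4 ->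
    measurable_fun setT (fun x => (h ((f1 x, f2 x, f3 x), f4 x))%:E).
  move=> m1 m2 m3 m4; apply/measurable_EFinP; apply: measurable_funM.
    by apply: measurableT_comp => //; exact: measurable_fun_pair.
  by apply: measurable_joint => //; apply: measurable_fun_pair => //; exact: measurable_fun_pair.
pose F (psi : Psi) := (\int[leb]_lam (h (psi, lam))%:E)%E.
have F0 psi : (0 <= F psi)%E by exact: integral_ge0.
have mF : measurable_fun setT F.
  apply: (@measurable_fun_fubini_tonelli_F _ _ _ _ _ leb (fun p => (h p)%:E)) => //.
  apply: (eq_measurable_fun (fun p : Psi * R => (h ((p.1.1.1, p.1.1.2, p.1.2), p.2))%:E)).
    by move=> [[[? ?] ?] ?].
  by apply: mh; mfun.
transitivity (\int[(P \x leb)%E]_psi F psi)%E.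
  rewrite integral_mkcond; apply: eq_integral => psi _.
  rewrite patchE /F; case: ifPn => [|/negP]; rewrite inE.
    move=> eta0; rewrite likelihood_prior_integral// -ge0_integralZl//.
    - by apply/measurable_EFinP; apply: measurable_joint.
    - by move=> lam _; rewrite lee_fin joint_ge0.
    - by rewrite lee_fin.
  move=> eta0; rewrite integral0_eq// => lam _.
  rewrite /h joint_eq0 ?mulr0//; apply/negP => /andP[? _]; exact: eta0.
rewrite (@fubini_tonelli2 _ _ _ _ _ P leb F)//.
pose f (p : R * R) : \bar R := ((joint_const * gamma_pair p.1 p.2)%:E *
  cond_mean ((p.1 + p.2)%R, (p.1 / (p.1 + p.2))%R))%E.
transitivity (\int[leb]_eta \int[leb]_lam
    (eta%:E * f ((lam * eta)%R, ((1 - lam) * eta)%R)))%E; last first.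
  apply: (@ge0_integral_quadrant _ f).
  - apply: emeasurable_funM; first by rewrite /gamma_pair; mfun.
    by apply: measurableT_comp; [exact: measurable_cond_mean|apply: measurable_fun_pair; mfun].
  - by move=> p; rewrite mule_ge0 ?cond_mean_ge0// lee_fin mulr_ge0 ?gamma_pair_ge0 ?(ltW joint_const_gt0).
  - by move=> x y xy; rewrite /f/= gamma_pair_eq0// mulr0 mul0e.
rewrite /f/=.
apply: eq_integral => eta _; rewrite /fubini_G /F.
rewrite (@fubini_tonelli _ _ _ _ _ P leb (fun p => (h ((p.1, eta), p.2))%:E))//; last first.
  apply: (eq_measurable_fun (fun p : (l.-tuple RT * q.-tuple RT) * R =>
    (h ((p.1.1, p.1.2, eta), p.2))%:E)); first by move=> [[? ?] ?].
  by apply: mh; mfun.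
apply: eq_integral => lam _.
rewrite (@fubini_tonelli1 _ _ _ _ _ (lebesgue_tuple l) (lebesgue_tuple q)
  (fun tm => (h ((tm, eta), lam))%:E))//; last first.
  apply: (eq_measurable_fun (fun p : (l.-tuple RT * q.-tuple RT) =>
    (h ((p.1, p.2, eta), lam))%:E)); first by move=> [? ?].
  by apply: mh; mfun.
have [/and3P[eta0 lam0 lam1]|H] := boolP [&& 0 < eta, 0 < lam & lam < 1]; last first.
  rewrite integral0_eq; first by rewrite gamma_pair_eq0_mix// mulr0 mul0e mule0.
  by move=> t _; rewrite /fubini_F integral0_eq// => u _; rewrite /h joint_eq0 ?mulr0.
have -> : lam * eta + (1 - lam) * eta = eta by rewrite -mulrDl addrC subrK mul1r.
rewrite mulfK ?gt_eqF// muleA -EFinM /cond_mean /=.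
set K := eta * _; have K0 : 0 <= K.
  apply: mulr_ge0; first exact: ltW.
  by apply: mulr_ge0; [exact: ltW joint_const_gt0|exact: gamma_pair_ge0].
have mgc : measurable_fun setT (fun t => (g (t, eta) * cond_pdf c d v eta lam t)%:E).
  apply/measurable_EFinP; apply: measurable_funM.
    exact: (measurableT_comp mg (measurable_fun_pair (@measurable_id _ _ _)
      (measurable_cst eta))).
  exact: measurable_cond_pdf.
have gc0 t : (0 <= (g (t, eta) * cond_pdf c d v eta lam t)%:E)%E.
  by rewrite lee_fin mulr_ge0 ?cond_pdf_ge0.
rewrite -[RHS]ge0_integralZl//.
apply: eq_integral => t _; rewrite /fubini_F.
transitivity (\int[lebesgue_tuple q]_u ((K * (g (t, eta) * cond_pdf c d v eta lam t))%:E *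
   (cond_pdf (const_mx gamma) (const_mx 1) vs eta lam u)%:E))%E.
  by apply: eq_integral => u _; rewrite -EFinM; congr EFin; rewrite /h /joint /K/=; ring.
rewrite ge0_integralZl//; try solve [by apply/measurable_EFinP; exact: measurable_cond_pdf
  | by move=> u _; rewrite lee_fin cond_pdf_ge0
  | by rewrite EFinM mule_ge0].
by rewrite integral_cond_pdf ?lam0// mule1 EFinM.
Qed.

End integration.
End joint_density.

(** * Moments of a pair of independent gamma variables *)

Section gamma_moments.
Context {R : realType}.
Local Notation leb := (@lebesgue_measure R).
Local Notation leb2 := (leb \x leb)%E.
Implicit Types (A B : R) (p : R * R).
Variables (ra rb : R).
Hypotheses (ra_gt0 : 0 < ra) (rb_gt0 : 0 < rb).

Definition gamma_prod A B p : R := gamma_density A ra p.1 * gamma_density B rb p.2.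

Lemma gamma_prod_ge0 A B p : 0 <= gamma_prod A B p.
Proof. by rewrite mulr_ge0 ?gamma_density_ge0. Qed.

Lemma gamma_prod_eq0 A B p : ~~ ((0 < p.1) && (0 < p.2)) -> gamma_prod A B p = 0.
Proof.
rewrite negb_and /gamma_prod /gamma_density.
by move=> /orP[]/negPf ->; rewrite ?mul0r ?mulr0.
Qed.

Lemma measurable_gamma_prod A B : measurable_fun setT (gamma_prod A B).
Proof. by rewrite /gamma_prod; mfun. Qed.

Lemma integral_gamma_prod A B : 0 < A -> 0 < B ->
  (\int[leb2]_p (gamma_prod A B p)%:E = gamma_mass A ra * gamma_mass B rb)%E.
Proof.
move=> A0 B0; rewrite fubini_tonelli1; last 2 first.
- by apply/measurable_EFinP; exact: measurable_gamma_prod.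
- by move=> p; rewrite lee_fin gamma_prod_ge0.
have mg z c : measurable_fun setT (fun t : R => (gamma_density z c t)%:E).
  by apply/measurable_EFinP; apply: measurable_gamma_density.
have g0 z c (t : R) : (0 <= (gamma_density z c t)%:E)%E by rewrite lee_fin gamma_density_ge0.
rewrite /fubini_F /gamma_prod/=.
under eq_integral => x _ do (under eq_integral do rewrite EFinM;
  rewrite ge0_integralZl//; try exact: mg).
by rewrite ge0_integralZr//; try solve [exact: mg | exact: integral_ge0].
Qed.

Lemma integrable_gamma_prod A B : 0 < A -> 0 < B ->
  leb2.-integrable setT (EFin \o gamma_prod A B).
Proof.
move=> A0 B0; apply/integrableP; split.
  by apply/measurable_EFinP; exact: measurable_gamma_prod.
under eq_integral do rewrite /= ger0_norm ?gamma_prod_ge0//.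
rewrite integral_gamma_prod//.
by rewrite lte_mul_pinfty ?gamma_mass_ge0 ?ge0_fin_numE ?gamma_mass_lty ?gamma_mass_ge0.
Qed.

Lemma gamma_prod_shapeA A B p : gamma_prod (A + 1) B p = gamma_prod A B p * p.1.
Proof. by rewrite /gamma_prod gamma_densityS -mulrA mulrC. Qed.

Lemma gamma_prod_shapeB A B p : gamma_prod A (B + 1) p = gamma_prod A B p * p.2.
Proof. by rewrite /gamma_prod gamma_densityS mulrCA mulrC. Qed.

(** This is lam, recovered from p = (x, y). *)
Definition mix_ratio p : R := p.1 / (p.1 + p.2).

Lemma mix_ratio_itv p : 0 < p.1 -> 0 < p.2 -> 0 < mix_ratio p < 1.
Proof.
move=> x0 y0; have xy0 := addr_gt0 x0 y0.
by rewrite /mix_ratio divr_gt0// ltr_pdivrMr// mul1r ltrDl.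
Qed.

Lemma measurable_mix_ratio : measurable_fun setT mix_ratio.
Proof. by rewrite /mix_ratio; mfun. Qed.

Lemma integrable_gamma_prod_ratio A B : 0 < A -> 0 < B ->
  leb2.-integrable setT (EFin \o (fun p => gamma_prod A B p * mix_ratio p)).
Proof.
move=> A0 B0; apply: le_integrable (integrable_gamma_prod A0 B0) => //.
  apply/measurable_EFinP; apply: measurable_funM; first exact: measurable_gamma_prod.
  exact: measurable_mix_ratio.
move=> p _ /=; rewrite lee_fin normrM.
have [/andP[x0 y0]|/gamma_prod_eq0 ->] := boolP ((0 < p.1) && (0 < p.2)); last first.
  by rewrite normr0 mul0r.
have /andP[l0 l1] := mix_ratio_itv x0 y0.
by rewrite ler_piMr// ger0_norm ltW.
Qed.

Section fixed_shapes.
Variables A B : R.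
Hypotheses (A_gt0 : 0 < A) (B_gt0 : 0 < B).

(** Unnormalised: expectations are quotients by [pair_moment (fun=> 1)]. Being real-valued, it
    carries information only together with an integrability statement. *)
Definition pair_moment (u : R * R -> R) : R :=
  \int[leb2]_p (gamma_prod A B p * u p).

Lemma integrable_moment_cst :
  leb2.-integrable setT (EFin \o (fun p => gamma_prod A B p * 1)).
Proof.
by apply: eq_integrable (integrable_gamma_prod A_gt0 B_gt0) => // p _; rewrite /= mulr1.
Qed.

Lemma integrable_moment_fst :
  leb2.-integrable setT (EFin \o (fun p => gamma_prod A B p * p.1)).
Proof.
apply: eq_integrable (integrable_gamma_prod (addr_gt0 A_gt0 ltr01) B_gt0) => // p _.
by rewrite /= gamma_prod_shapeA.
Qed.

Lemma integrable_moment_snd :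
  leb2.-integrable setT (EFin \o (fun p => gamma_prod A B p * p.2)).
Proof.
apply: eq_integrable (integrable_gamma_prod A_gt0 (addr_gt0 B_gt0 ltr01)) => // p _.
by rewrite /= gamma_prod_shapeB.
Qed.

Lemma integrable_moment_ratio :
  leb2.-integrable setT (EFin \o (fun p => gamma_prod A B p * mix_ratio p)).
Proof. exact: integrable_gamma_prod_ratio. Qed.

Lemma integrable_moment_fst_ratio :
  leb2.-integrable setT (EFin \o (fun p => gamma_prod A B p * (p.1 * mix_ratio p))).
Proof.
have := integrable_gamma_prod_ratio (addr_gt0 A_gt0 ltr01) B_gt0.
by apply: eq_integrable => // p _; rewrite /= gamma_prod_shapeA mulrA.
Qed.

Let gA_fin z : 0 < z -> gamma_mass z ra \is a fin_num.
Proof. by move=> z0; rewrite ge0_fin_numE ?gamma_mass_ge0 ?gamma_mass_lty. Qed.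

Let gB_fin z : 0 < z -> gamma_mass z rb \is a fin_num.
Proof. by move=> z0; rewrite ge0_fin_numE ?gamma_mass_ge0 ?gamma_mass_lty. Qed.

Lemma pair_moment1E :
  pair_moment (fun=> 1) = fine (gamma_mass A ra) * fine (gamma_mass B rb).
Proof.
have E : (\int[leb2]_p (gamma_prod A B p * 1)%:E =
    gamma_mass A ra * gamma_mass B rb)%E.
  by rewrite -integral_gamma_prod//; apply: eq_integral => p _; rewrite mulr1.
by rewrite /pair_moment /Rintegral E fineM ?gA_fin ?gB_fin.
Qed.

Lemma pair_moment1_gt0 : 0 < pair_moment (fun=> 1).
Proof.
rewrite pair_moment1E mulr_gt0// fine_gt0// gamma_mass_gt0/=.
  exact: gamma_mass_lty.
exact: gamma_mass_lty.
Qed.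

Lemma pair_moment_fst : pair_moment fst = A / ra * pair_moment (fun=> 1).
Proof.
have E : (\int[leb2]_p (gamma_prod A B p * p.1)%:E =
    (A / ra)%:E * gamma_mass A ra * gamma_mass B rb)%E.
  rewrite -gamma_mass_rec// -integral_gamma_prod// ?addr_gt0//.
  by apply: eq_integral => p _; rewrite gamma_prod_shapeA.
rewrite pair_moment1E /pair_moment /Rintegral E.
by rewrite fineM ?gB_fin ?fin_numM ?gA_fin// fineM ?gA_fin// mulrA.
Qed.

Lemma pair_moment_snd : pair_moment snd = B / rb * pair_moment (fun=> 1).
Proof.
have E : (\int[leb2]_p (gamma_prod A B p * p.2)%:E =
    gamma_mass A ra * ((B / rb)%:E * gamma_mass B rb))%E.
  rewrite -gamma_mass_rec// -integral_gamma_prod// ?addr_gt0//.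
  by apply: eq_integral => p _; rewrite gamma_prod_shapeB.
rewrite pair_moment1E /pair_moment /Rintegral E.
by rewrite fineM ?gA_fin ?fin_numM ?gB_fin// fineM ?gB_fin// mulrCA.
Qed.

(** The functions 1, lam, x, y and x lam are the ones that the conditional expectation of eta |y~ -
    Q theta|^2 is made of. *)
Lemma integral_pair_linear (a1 a2 a3 a4 a5 : R) :
  (\int[leb2]_p (gamma_prod A B p *
     (a1 + a2 * mix_ratio p + a3 * p.1 + a4 * p.2 + a5 * (p.1 * mix_ratio p)))%:E =
   (a1 * pair_moment (fun=> 1) + a2 * pair_moment mix_ratio + a3 * pair_moment fst +
    a4 * pair_moment snd + a5 * pair_moment (fun p => p.1 * mix_ratio p)%R)%:E)%E.
Proof.
have Z k u : leb2.-integrable setT (EFin \o (fun p => gamma_prod A B p * u p)) ->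
    leb2.-integrable setT (fun p => k%:E * (EFin \o (fun p => gamma_prod A B p * u p)%R) p)%E.
  exact: integrableZl.
have V k u : leb2.-integrable setT (EFin \o (fun p => gamma_prod A B p * u p)) ->
    (\int[leb2]_p (k%:E * (EFin \o (fun p => gamma_prod A B p * u p)%R) p) =
     (k * pair_moment u)%:E)%E.
  by move=> iu; rewrite integralZl// EFinM fineK// integrable_fin_num.
have i1 := Z a1 _ integrable_moment_cst; have i2 := Z a2 _ integrable_moment_ratio.
have i3 := Z a3 _ integrable_moment_fst; have i4 := Z a4 _ integrable_moment_snd.
have i5 := Z a5 _ integrable_moment_fst_ratio.
rewrite !EFinD -!V; try solve [exact: integrable_moment_cst | exact: integrable_moment_ratio
  | exact: integrable_moment_fst | exact: integrable_moment_snd | exact: integrable_moment_fst_ratio].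
rewrite -!integralD//; try by do ?apply: integrableD.
by apply: eq_integral => p _; rewrite /= -!EFinM -!EFinD; congr EFin; ring.
Qed.

(* The logarithm of x + y is dominated at 0 by a negative power of y that is
   small enough for the gamma density in y to absorb. *)
Lemma integral_pair_log_lty (t k : R) : 0 <= k ->
  (\int[leb2]_p (gamma_prod A B p * (k * `|ln (p.1 + p.2) - t|))%:E < +oo)%E.
Proof.
move=> k0.
have e0 : 0 < B / 2 by rewrite divr_gt0.
have iy : leb2.-integrable setT (EFin \o gamma_prod A (B / 2)).
  exact: integrable_gamma_prod.
have i1 := integrable_gamma_prod A_gt0 B_gt0.
have ix := integrable_moment_fst; have i2 := integrable_moment_snd.
(* The majorant comes from ln u <= u and, applied to u^(-B/2), from - ln u <= u^(-B/2) / (B/2),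
   where u = x + y >= y. The exponent B/2 leaves the positive shape B/2 in y. *)
pose F := (fun p => (k * `|t|)%:E * (EFin \o gamma_prod A B) p +
  k%:E * ((EFin \o (fun p => gamma_prod A B p * p.1)%R) p) +
  k%:E * ((EFin \o (fun p => gamma_prod A B p * p.2)%R) p) +
  (k / (B / 2))%:E * (EFin \o gamma_prod A (B / 2)) p)%E.
have iF : leb2.-integrable setT F.
  by do ?apply: integrableD => //; exact: integrableZl.
suff /integrableP[_] : leb2.-integrable setT
    (EFin \o (fun p => gamma_prod A B p * (k * `|ln (p.1 + p.2) - t|))).
  apply: le_lt_trans; rewrite le_eqVlt; apply/orP; left; apply/eqP.
  apply: eq_integral => p _ /=; congr EFin; apply/esym; rewrite ger0_norm//.
  by apply: mulr_ge0; [exact: gamma_prod_ge0|exact: mulr_ge0].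
apply: le_integrable iF => //.
  apply/measurable_EFinP; apply: measurable_funM; first exact: measurable_gamma_prod.
  apply: measurable_funM => //; apply: measurableT_comp => //; mfun.
move=> p _ /=; rewrite /F/= -?EFinM -?EFinD lee_fin.
rewrite ger0_norm; last by apply: mulr_ge0; [exact: gamma_prod_ge0|exact: mulr_ge0].
apply: le_trans (ler_norm _).
have [/andP[x0 y0]|N] := boolP ((0 < p.1) && (0 < p.2)); last first.
  by rewrite !gamma_prod_eq0// !(mul0r, mulr0, addr0).
have xy0 := addr_gt0 x0 y0.
have -> : gamma_prod A (B / 2) p = gamma_prod A B p * p.2 `^ (- (B / 2)).
  rewrite /gamma_prod /gamma_density x0 y0.
  have -> : B / 2 - 1 = (B - 1) + (- (B / 2)) by field.
  by rewrite (@powRD _ p.2 (B - 1) (- (B / 2))) ?(gt_eqF y0) ?implybT//; ring.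
rewrite [leRHS](_ : _ = gamma_prod A B p * (k * (`|t| + (p.1 + p.2) +
  p.2 `^ (- (B / 2)) / (B / 2)))); last by ring.
rewrite ler_wpM2l ?gamma_prod_ge0// ler_wpM2l//.
rewrite (le_trans (ler_normB _ _))// [leLHS]addrC -addrA lerD2l.
have P0 : 0 <= p.2 `^ (- (B / 2)) / (B / 2) by rewrite divr_ge0 ?powR_ge0// ltW.
have lnle (z : R) : 0 < z -> ln z <= z by move=> z0; exact: ltW (ln_sublinear z0).
rewrite ler_norml; apply/andP; split; last first.
  by rewrite (le_trans (lnle _ xy0))// lerDl.
rewrite lerNl; apply: (@le_trans _ _ (p.2 `^ (- (B / 2)) / (B / 2))); last first.
  by rewrite lerDr ltW.
rewrite ler_pdivlMr// [leLHS](_ : _ = - (B / 2) * ln (p.1 + p.2)); last by ring.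
rewrite -ln_powR.
apply: (le_trans (lnle _ (powR_gt0 _ xy0))).
rewrite !powRN lef_pV2 ?posrE ?powR_gt0//.
by apply: ge0_ler_powR; rewrite ?nnegrE ?ltW// ltrDr.
Qed.

End fixed_shapes.
End gamma_moments.

(** * Subtraction of integrals against an extended-real density *)

Section integral_diff.
Context d (T : measurableType d) (R : realType).
Variables (mu : {measure set T -> \bar R}) (D : set T).
Local Open Scope ereal_scope.

(* The density P may be infinite on a null set, where (f1 - f2) P and
   f1 P - f2 P differ. *)
Lemma integral_diff_density (f1 f2 : T -> R) (P : T -> \bar R) (A1 A2 : R) :
  measurable D -> measurable_fun setT f1 -> measurable_fun setT f2 ->
  measurable_fun D P -> (forall x, 0 <= f1 x)%R -> (forall x, 0 <= f2 x)%R ->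
  (forall x, D x -> 0 <= P x) -> \int[mu]_(x in D) P x < +oo ->
  \int[mu]_(x in D) ((f1 x)%:E * P x) = A1%:E ->
  \int[mu]_(x in D) ((f2 x)%:E * P x) = A2%:E ->
  mu.-integrable D (fun x => (f1 x - f2 x)%:E * P x) /\
  \int[mu]_(x in D) ((f1 x - f2 x)%:E * P x) = (A1 - A2)%:E.
Proof.
move=> mD mf1 mf2 mP f1_ge0 f2_ge0 P0 Plt I1 I2.
have mfP (f : T -> R) : measurable_fun setT f ->
    measurable_fun D (fun x => (f x)%:E * P x).
  by move=> mf; apply: emeasurable_funM => //; apply: measurable_funTS; mfun.
have int_fP (f : T -> R) A : measurable_fun setT f -> (forall x, 0 <= f x)%R ->
    \int[mu]_(x in D) ((f x)%:E * P x) = A%:E ->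
    mu.-integrable D (fun x => (f x)%:E * P x).
  move=> mf f_ge0 I; apply/integrableP; split; first exact: mfP.
  rewrite (eq_integral (fun x => (f x)%:E * P x)) ?I ?ltry// => x.
  by rewrite inE => Dx; rewrite gee0_abs// mule_ge0 ?lee_fin ?P0.
have i1 := int_fP _ _ mf1 f1_ge0 I1; have i2 := int_fP _ _ mf2 f2_ge0 I2.
have mB : measurable_fun D (fun x => (f1 x - f2 x)%:E * P x) by apply: mfP; mfun.
have iB : mu.-integrable D (fun x => (f1 x - f2 x)%:E * P x).
  apply: le_integrable (integrableD mD i1 i2) => // x Dx.
  rewrite abseM (gee0_abs (P0 _ Dx)) -ge0_muleDl ?lee_fin// [leRHS]gee0_abs; last first.
    by rewrite mule_ge0 ?P0// -EFinD lee_fin addr_ge0.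
  rewrite lee_wpmul2r ?P0// -EFinD lee_fin (le_trans (ler_normB _ _))//.
  by rewrite !ger0_norm.
split=> //; rewrite EFinB -I1 -I2 -integralB//.
apply: ae_eq_integral => //; first exact: emeasurable_funB (mfP _ mf1) (mfP _ mf2).
have iP : mu.-integrable D P.
  apply/integrableP; split => //.
  rewrite (eq_integral P) // => x; rewrite inE => Dx.
  by rewrite gee0_abs// P0.
(* Integrability makes P finite almost everywhere, and there the product distributes over the
   difference. *)
have := integrable_ae mD iP; apply: filterS => x H Dx.
have := H Dx; move: (P x) => [p| |] // _.
by rewrite -EFinM -!EFinM -EFinB mulrBl.
Qed.

End integral_diff.

(** * Orthogonal decomposition of the squared distance *)

Section sqdist.
Context {R : realType}.

Definition sqnorm n (u : 'cV[R]_n) : R := \sum_i u i ord0 ^+ 2.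

Lemma sqnormE n (u : 'cV[R]_n) : sqnorm u = (u^T *m u) ord0 ord0.
Proof. by rewrite mxE; apply: eq_bigr => i _; rewrite mxE. Qed.

Lemma sqnorm_ge0 n (u : 'cV[R]_n) : 0 <= sqnorm u.
Proof. by apply: sumr_ge0 => i _; exact: sqr_ge0. Qed.

Variables (m l : nat) (Q : 'M[R]_(m, l)).
Hypothesis QQ : Q^T *m Q = 1%:M.

(** The squared distance from y to the range of Q. *)
Definition residual (y : 'cV[R]_m) : R := sqnorm y - sqnorm (Q^T *m y).

(** Pythagoras: Q Q' is the orthogonal projection onto the range of Q, and Q preserves norms. The
    dependence on theta is reduced to its l separate coordinates. *)
Lemma sqdist_decomp (y : 'cV[R]_m) (th : 'cV[R]_l) :
  sqnorm (y - Q *m th) = residual y + sqnorm (th - Q^T *m y).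
Proof.
rewrite /residual !sqnormE !linearB/= !trmx_mul trmxK !mulmxBl.
have entryB (X Y : 'M[R]_1) : (X - Y) ord0 ord0 = X ord0 ord0 - Y ord0 ord0.
  by rewrite !mxE.
rewrite !mulmxA -(mulmxA th^T Q^T Q) QQ mulmx1 !entryB.
lra.
Qed.

Lemma residual_ge0 y : 0 <= residual y.
Proof.
have := sqdist_decomp y (Q^T *m y); rewrite subrr.
have -> : sqnorm (0 : 'cV[R]_l) = 0.
  by apply: big1 => i _; rewrite mxE expr0n.
by rewrite addr0 => <-; exact: sqnorm_ge0.
Qed.

End sqdist.

(** * Logarithm of the spherical normal density *)

Section log_density.
Context {R : realType}.

Definition log_norm (m : nat) (eta : R) : R := m%:R / 2 * (ln eta - ln (2 * pi)).

Lemma mvn_pdf_expR m (mean y : 'cV[R]_m) (eta : R) : 0 < eta ->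
  mvn_pdf mean (eta^-1)%:M y = expR (log_norm m eta - eta / 2 * sqnorm (y - mean)).
Proof.
move=> eta0; rewrite mvn_pdf_scalar ?invr_gt0// invrK.
have p0 : 0 < 2 * pi :> R by rewrite mulr_gt0// pi_gt0.
rewrite (eq_bigr (fun i => expR ((ln eta - ln (2 * pi)) / 2 -
    eta / 2 * (y - mean) i ord0 ^+ 2))); last first.
  move=> i _; rewrite /gauss !mxE expRD; congr (_ * expR _); last by field.
  rewrite -powR12_sqrt ?divr_ge0 ?ltW// /powR gt_eqF ?divr_gt0//.
  by rewrite ln_div ?posrE// mulrC.
rewrite -expR_sum; congr expR; rewrite big_split/= sumrN -mulr_sumr; congr (_ - _).
  by rewrite sumr_const card_ord /log_norm -mulr_natl; field.
by rewrite /sqnorm mulr_sumr.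
Qed.

Lemma integral_mvn_pdf_scalar m (mean : 'cV[R]_m) (e : R) : 0 < e ->
  (\int[lebesgue_tuple m]_z (mvn_pdf mean e%:M (colt z))%:E = 1)%E.
Proof.
move=> e0.
transitivity (\int[lebesgue_tuple m]_z
    (\prod_i gauss e^-1 (mean i ord0) (tnth z i))%:E)%E.
  apply: eq_integral => z _; rewrite mvn_pdf_scalar//; congr EFin.
  by apply: eq_bigr => i _; rewrite mxE.
rewrite (@integral_prod_tnth _ _ (fun i => gauss _ _) (fun=> 1)) ?big1//.
- by move=> i; apply: measurable_gauss.
- by move=> i t; exact: gauss_ge0.
- by move=> i; apply: integral_gauss; rewrite invr_gt0.
Qed.

End log_density.

Lemma normrD_ge0 (R : realDomainType) (x : R) : 0 <= `|x| + x.
Proof. by have := ler_norm (- x); rewrite normrN; lra. Qed.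

(** * Posterior expectation of the log density *)

Section posterior_expectation.
Context {R : realType}.
Local Notation RT := (measurableTypeR R).
Local Notation leb := (@lebesgue_measure R).
Local Notation leb2 := (leb \x leb)%E.
Variables (l q r m : nat) (c d : 'rV[R]_l) (gamma a s : R).
Variables (v : 'cV[R]_l) (vs : 'cV[R]_q) (Q : 'M[R]_(m, l)).
Hypothesis r_gt0 : (0 < r)%N.
Hypothesis c_ge1 : forall i, 1 <= c ord0 i.
Hypothesis d_gt0 : forall i, 0 < d ord0 i.
Hypothesis gamma_ge1 : 1 <= gamma.
Hypothesis s_gt0 : 0 < s.
Hypothesis a_gt : - ((l + q)%:R / 2) - 1 < a.
Hypothesis QQ : Q^T *m Q = 1%:M.

Local Notation Psi := (l.-tuple RT * q.-tuple RT * RT)%type.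
Local Notation Lik := (likelihood r (diag_mx d) v vs s).
Local Notation Prior :=
  (hier_prior (diag_mx d) (diag_mx c) gamma a (r%:R / 2 - 1)).
Local Notation mu := (param_measure R l q).
Local Notation Theta := (param_space R l q).
Local Notation pA := (shapeA l q a).
Local Notation pB := (@shapeB R r).
Local Notation rA := (rateA c d gamma s v vs).
Local Notation rB := (rateB s).
Local Notation jc := (joint_const q r c d gamma s).
Local Notation gp := (gamma_prod rA rB pA pB).
Local Notation pm := (pair_moment rA rB pA pB).

Lemma shapeA_gt0 : 0 < pA.
Proof. by rewrite /shapeA -ltrBlDr sub0r -ltrBlDl addrC. Qed.

Lemma rateB_gt0 : 0 < rB.
Proof. by rewrite divr_gt0. Qed.

Lemma rateA_gt0 : 0 < rA.
Proof.
rewrite divr_gt0// ltr_wpDr// addr_ge0// marg_quad_ge0// => i; rewrite mxE//.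
Qed.

Let pA0 : 0 < pA. Proof. exact: shapeA_gt0. Qed.
Let pB0 : 0 < pB. Proof. exact: shapeB_gt0. Qed.
Let rA0 : 0 < rA. Proof. exact: rateA_gt0. Qed.
Let rB0 : 0 < rB. Proof. exact: rateB_gt0. Qed.
Let jc0 : 0 < jc. Proof. exact: joint_const_gt0. Qed.

(** Passes to the product measure, on which the moments are known to be finite. The formula [u] is
    required only for eta > 0 and 0 < lam < 1, because the gamma densities vanish off the
    quadrant. *)
Lemma integral_likelihood_prior_pair (g : l.-tuple RT * RT -> R) (u : R -> R -> R) :
  measurable_fun setT g -> (forall p, 0 <= g p) ->
  measurable_fun setT (fun p : R * R => u p.1 p.2) ->
  (forall eta lam, 0 < eta -> 0 < lam < 1 -> cond_mean c d v g (eta, lam) = (u eta lam)%:E) ->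
  (\int[mu]_(psi in Theta) ((g (psi.1.1, psi.2))%:E * ((Lik psi)%:E * Prior psi)) =
   jc%:E * \int[leb2]_p (gp p * u (p.1 + p.2) (mix_ratio p))%:E)%E.
Proof.
move=> mg g0 mu' gu.
have gpu p : (gp p * u (p.1 + p.2) (mix_ratio p))%:E =
    ((gp p)%:E * cond_mean c d v g (p.1 + p.2, mix_ratio p)%R)%E.
  have [/andP[x0 y0]|/gamma_prod_eq0 ->] := boolP ((0 < p.1) && (0 < p.2)); last first.
    by rewrite mul0r mul0e.
  by rewrite gu ?addr_gt0 ?mix_ratio_itv.
have gpu0 p : (0 <= (gp p * u (p.1 + p.2) (mix_ratio p))%:E)%E.
  by rewrite gpu mule_ge0 ?cond_mean_ge0// lee_fin gamma_prod_ge0.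
have mgpu : measurable_fun setT (fun p => (gp p * u (p.1 + p.2) (mix_ratio p))%:E).
  apply/measurable_EFinP; apply: measurable_funM; first exact: measurable_gamma_prod.
  apply: (measurableT_comp (f := fun p : R * R => u p.1 p.2)
    (g := fun p : R * R => (p.1 + p.2, mix_ratio p)) mu').
  by apply: measurable_fun_pair; [mfun|exact: measurable_mix_ratio].
rewrite integral_likelihood_prior// fubini_tonelli1//.
rewrite -ge0_integralZl//; last 3 first.
- exact: (@measurable_fun_fubini_tonelli_F _ _ _ _ _ leb _ mgpu gpu0).
- by move=> x _; exact: integral_ge0.
- by rewrite lee_fin ltW.
apply: eq_integral => x _; rewrite /fubini_F -ge0_integralZl//; try solve [apply: (measurableT_comp mgpu); exact: measurable_fun_pair | by rewrite lee_fin ltW].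
apply: eq_integral => y _; rewrite gpu/= muleA -EFinM.
by [].
Qed.

Lemma integral_cond_mean1 eta lam : 0 < eta -> 0 < lam < 1 ->
  cond_mean c d v (fun=> 1) (eta, lam) = 1%:E.
Proof.
move=> eta0 lam01; rewrite /cond_mean/=.
by under eq_integral do rewrite mul1r; exact: integral_cond_pdf.
Qed.

Lemma marginalE : marginal mu Theta Lik Prior = (jc * pm (fun=> 1))%:E.
Proof.
rewrite /marginal.
transitivity (\int[mu]_(psi in Theta) (((fun=> 1) (psi.1.1, psi.2))%:E *
    ((Lik psi)%:E * Prior psi)))%E.
  by apply: eq_integral => psi _; rewrite mul1e.
rewrite (@integral_likelihood_prior_pair (fun=> 1) (fun _ _ => 1))//; last first.
  exact: integral_cond_mean1.
rewrite [RHS]EFinM; congr (_ * _)%E; rewrite /pair_moment/= /Rintegral fineK//.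
by rewrite integrable_fin_num//; exact: integrable_moment_cst.
Qed.

Lemma marginal_gt0 : (0 < marginal mu Theta Lik Prior)%E.
Proof. by rewrite marginalE lte_fin mulr_gt0// pair_moment1_gt0. Qed.

Local Notation M := (jc * pm (fun=> 1)).

Let M0 : 0 < M.
Proof. by rewrite mulr_gt0// pair_moment1_gt0. Qed.

Lemma lik_prior_ge0 (psi : Psi) : Theta psi -> (0 <= (Lik psi)%:E * Prior psi)%E.
Proof.
move=> eta0; rewrite likelihood_prior_integral//.
by apply: integral_ge0 => lam _; rewrite lee_fin joint_ge0.
Qed.

Lemma integral_posterior (g : Psi -> R) (A : R) :
  measurable_fun setT g -> (forall psi, 0 <= g psi) ->
  (\int[mu]_(psi in Theta) ((g psi)%:E * ((Lik psi)%:E * Prior psi)) = (jc * A)%:E ->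
  \int[mu]_(psi in Theta) ((g psi)%:E * posterior mu Theta Lik Prior psi) =
  (A / pm (fun=> 1))%:E)%E.
Proof.
move=> mg g0 I.
have mLP : measurable_fun Theta (fun psi => (Lik psi)%:E * Prior psi)%E.
  exact: measurable_likelihood_prior.
transitivity (\int[mu]_(psi in Theta) ((M^-1)%:E *
    ((g psi)%:E * ((Lik psi)%:E * Prior psi))))%E.
  apply: eq_integral => psi _; rewrite /posterior marginalE/=.
  by rewrite [RHS]muleC [LHS]muleA.
rewrite ge0_integralZl//; last 4 first.
- exact: measurable_param_space.
- apply: emeasurable_funM => //; apply: measurable_funTS; exact/measurable_EFinP.
- by move=> psi Dpsi; rewrite mule_ge0 ?lik_prior_ge0// lee_fin.
- by rewrite lee_fin invr_ge0 ltW.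
rewrite I -EFinM; congr EFin; rewrite invfM mulrACA mulVf ?mul1r 1?mulrC//.
by rewrite gt_eqF.
Qed.

Local Notation w := (fun yt j => (Q^T *m yt) j ord0).

(** With [pred_coef2], the coefficients of x and y in the conditional expectation of eta |y~ - Q
    theta|^2; all dependence on y~ is in these two. *)
Definition pred_coef1 (yt : 'cV[R]_m) : R := residual Q yt +
  \sum_j ((v j ord0 - w yt j) ^+ 2 - 2 * (v j ord0 - w yt j) * (v j ord0 / c ord0 j)).
Definition pred_coef2 (yt : 'cV[R]_m) : R := residual Q yt + \sum_j (v j ord0 - w yt j) ^+ 2.

(** By [sqdist_decomp] this is |y~ - Q theta|^2, with theta given as a tuple. *)
Definition sqdist_tuple (yt : 'cV[R]_m) (t : l.-tuple RT) : R :=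
  residual Q yt + \sum_j (tnth t j - w yt j) ^+ 2.

Lemma sqdist_tuple_ge0 yt t : 0 <= sqdist_tuple yt t.
Proof.
by rewrite addr_ge0 ?residual_ge0//; apply: sumr_ge0 => j _; exact: sqr_ge0.
Qed.

Lemma measurable_sqdist_tuple yt d0 (T : measurableType d0) (f : T -> l.-tuple RT) :
  measurable_fun setT f -> measurable_fun setT (fun x => sqdist_tuple yt (f x)).
Proof.
move=> mf; rewrite /sqdist_tuple; apply: measurable_funD => //.
have := @measurable_sum _ T R setT 'I_l (index_enum 'I_l)
  (fun j x => (tnth (f x) j - w yt j) ^+ 2); apply => j.
apply: measurable_funX; apply: measurable_funB => //.
exact: (measurableT_comp (@measurable_tnth _ RT l j) mf).
Qed.

(** The conditional variances are proportional to 1 / eta, so the factor eta cancels in them. The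
    summand [L] makes room for the absolute value of [log_norm]. *)
Lemma cond_mean_sqdist (yt : 'cV[R]_m) (L eta lam : R) : 0 <= L -> 0 < eta -> 0 < lam < 1 ->
  (\int[lebesgue_tuple l]_t ((L + eta / 2 * sqdist_tuple yt t) * cond_pdf c d v eta lam t)%:E =
  (L + (eta * residual Q yt +
    \sum_j (gauss_variance * (d ord0 j * (1 - lam / c ord0 j)) +
      eta * ((1 - lam / c ord0 j) * v j ord0 - w yt j) ^+ 2)) / 2)%:E)%E.
Proof.
move=> L0 eta0 lam01.
have mc : measurable_fun setT (fun t => (cond_pdf c d v eta lam t)%:E).
  by apply/measurable_EFinP; exact: measurable_cond_pdf.
have c0 t : (0 <= (cond_pdf c d v eta lam t)%:E)%E by rewrite lee_fin cond_pdf_ge0.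
have mj j : measurable_fun setT
    (fun t => (cond_pdf c d v eta lam t * (tnth t j - w yt j) ^+ 2)%:E).
  apply/measurable_EFinP; apply: measurable_funM; first exact: measurable_cond_pdf.
  apply: measurable_funX; apply: measurable_funB => //; exact: measurable_tnth.
have j0 j t : (0 <= (cond_pdf c d v eta lam t * (tnth t j - w yt j) ^+ 2)%:E)%E.
  by rewrite lee_fin mulr_ge0 ?cond_pdf_ge0 ?sqr_ge0.
have K0 : 0 <= L + eta / 2 * residual Q yt.
  by rewrite addr_ge0// mulr_ge0 ?residual_ge0// divr_ge0// ltW.
have e0 : 0 <= eta / 2 by rewrite divr_ge0// ltW.
transitivity (\int[lebesgue_tuple l]_t ((L + eta / 2 * residual Q yt)%:E * (cond_pdf c d v eta lam t)%:E +
   (eta / 2)%:E * \sum_j (cond_pdf c d v eta lam t * (tnth t j - w yt j) ^+ 2)%:E))%E.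
  apply: eq_integral => t _; rewrite sumEFin -!EFinM -EFinD; congr EFin.
  by rewrite /sqdist_tuple -mulr_sumr; ring.
have ms : measurable_fun setT (fun t => \sum_j
    (cond_pdf c d v eta lam t * (tnth t j - w yt j) ^+ 2)%:E)%E.
  by apply: emeasurable_sum => j.
have s0 t : (0 <= \sum_j (cond_pdf c d v eta lam t * (tnth t j - w yt j) ^+ 2)%:E)%E.
  by apply: sume_ge0 => j _.
rewrite ge0_integralD//; try solve [by apply: measurable_funeM
  | by move=> t _; rewrite mule_ge0// lee_fin].
rewrite !ge0_integralZl// integral_cond_pdf// ge0_integral_sum//.
under eq_bigr do rewrite integral_cond_pdf_sqr//.
rewrite sumEFin mule1 -EFinM -EFinD; congr EFin.
rewrite mulrDl mulr_sumr mulr_suml addrA; congr (_ + _ + _); first by field.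
apply: eq_bigr => j _; field.
by rewrite !gt_eqF// (lt_le_trans ltr01).
Qed.

(** Expanding the squares produces eta, eta lam and eta lam^2, which are x + y, x and x (x / (x +
    y)). Only the last is not linear in (x, y), and its coefficient is free of y~. *)
Lemma gamma_pair_quad (yt : 'cV[R]_m) (x y : R) : 0 < x -> 0 < y ->
  (x + y) * residual Q yt +
    \sum_j (gauss_variance * (d ord0 j * (1 - x / (x + y) / c ord0 j)) +
      (x + y) * ((1 - x / (x + y) / c ord0 j) * v j ord0 - w yt j) ^+ 2) =
  \sum_j gauss_variance * d ord0 j +
  - (\sum_j gauss_variance * (d ord0 j / c ord0 j)) * (x / (x + y)) +
  pred_coef1 yt * x + pred_coef2 yt * y +
  (\sum_j (v j ord0 / c ord0 j) ^+ 2) * (x * (x / (x + y))).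
Proof.
move=> x0 y0; have xy0 : x + y != 0 by rewrite gt_eqF ?addr_gt0.
transitivity (x * residual Q yt + y * residual Q yt + \sum_j (
  gauss_variance * d ord0 j + - (gauss_variance * (d ord0 j / c ord0 j) * (x / (x + y))) +
  ((v j ord0 - w yt j) ^+ 2 - 2 * (v j ord0 - w yt j) * (v j ord0 / c ord0 j)) * x +
  (v j ord0 - w yt j) ^+ 2 * y + (v j ord0 / c ord0 j) ^+ 2 * (x * (x / (x + y))))).
  congr (_ + _); first by ring.
  apply: eq_bigr => j _; field.
  by rewrite xy0 gt_eqF// (lt_le_trans ltr01).
by rewrite !big_split/= sumrN -!mulr_suml /pred_coef1 /pred_coef2; ring.
Qed.

Local Notation Ex := (pA / rA).
Local Notation Ey := (pB / rB).
Local Notation L := (@log_norm R m).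

Definition post_ratio : R := Ex / (Ex + Ey).

Definition theta_bayes : 'cV[R]_l := \col_j ((1 - post_ratio / c ord0 j) * v j ord0).

Lemma post_precision_gt0 : 0 < Ex + Ey.
Proof. by rewrite addr_gt0// divr_gt0. Qed.

(** After division by Ex + Ey, coordinate j reads (v - w)^2 - 2 rho (v - w) v / c with rho =
    [post_ratio], that is ((1 - rho / c) v - w)^2 - rho^2 (v / c)^2. *)
Lemma pred_coef_complete_square yt :
  pred_coef1 yt * Ex + pred_coef2 yt * Ey =
  (Ex + Ey) * (sqnorm (yt - Q *m theta_bayes) -
    post_ratio ^+ 2 * \sum_j (v j ord0 / c ord0 j) ^+ 2).
Proof.
have H0 := post_precision_gt0.
have ExE : Ex = post_ratio * (Ex + Ey) by rewrite /post_ratio divfK// gt_eqF.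
have EyE : Ey = (1 - post_ratio) * (Ex + Ey) by rewrite mulrBl -ExE; ring.
rewrite [in LHS]ExE [in X in _ + X]EyE sqdist_decomp//.
rewrite /pred_coef1 /pred_coef2 /sqnorm.
have -> : \sum_i (theta_bayes - Q^T *m yt) i ord0 ^+ 2 =
    \sum_i (v i ord0 - w yt i) ^+ 2 +
    post_ratio * (\sum_i ((v i ord0 - w yt i) ^+ 2 -
      2 * (v i ord0 - w yt i) * (v i ord0 / c ord0 i))) +
    (- post_ratio) * (\sum_i (v i ord0 - w yt i) ^+ 2) +
    post_ratio ^+ 2 * (\sum_i (v i ord0 / c ord0 i) ^+ 2).
  transitivity (\sum_i (
    (v i ord0 - w yt i) ^+ 2 +
    post_ratio * ((v i ord0 - w yt i) ^+ 2 -
      2 * (v i ord0 - w yt i) * (v i ord0 / c ord0 i)) +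
    (- post_ratio) * (v i ord0 - w yt i) ^+ 2 +
    post_ratio ^+ 2 * (v i ord0 / c ord0 i) ^+ 2)); last first.
    by rewrite 3!big_split/= -!mulr_sumr.
  apply: eq_bigr => i _.
  have -> : (theta_bayes - Q^T *m yt) i ord0 =
      (1 - post_ratio / c ord0 i) * v i ord0 - w yt i by rewrite !mxE.
  by move: ((Q^T *m yt) i ord0) => z; ring.
ring.
Qed.

Let abs_log_ge0 p : (0 <= (gp p * `|L (p.1 + p.2)|)%:E)%E.
Proof. by rewrite lee_fin; apply: mulr_ge0; [exact: gamma_prod_ge0|]. Qed.

Let measurable_L : measurable_fun setT (fun p : R * R => L (p.1 + p.2)).
Proof. by rewrite /log_norm; mfun. Qed.

Let measurable_abs_log : measurable_fun setT (fun p => (gp p * `|L (p.1 + p.2)|)%:E).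
Proof.
apply/measurable_EFinP; apply: measurable_funM; first exact: measurable_gamma_prod.
exact: measurableT_comp.
Qed.

Let integral_abs_log_lty : (\int[leb2]_p (gp p * `|L (p.1 + p.2)|)%:E < +oo)%E.
Proof.
have k0 : 0 <= m%:R / 2 :> R by rewrite divr_ge0.
have := integral_pair_log_lty rA0 rB0 pA0 pB0 (ln (2 * pi)) k0.
apply: le_lt_trans; rewrite le_eqVlt; apply/orP; left; apply/eqP.
by apply: eq_integral => p _; rewrite /log_norm normrM (ger0_norm k0).
Qed.

Lemma integral_abs_log : (\int[leb2]_p (gp p * `|L (p.1 + p.2)|)%:E =
  (pm (fun p => `|L (p.1 + p.2)|))%:E)%E.
Proof. by rewrite /pair_moment /Rintegral fineK// ge0_fin_numE ?integral_ge0. Qed.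

Lemma integral_pos_log : (\int[leb2]_p (gp p * (`|L (p.1 + p.2)| + L (p.1 + p.2)))%:E =
  (pm (fun p => `|L (p.1 + p.2)| + L (p.1 + p.2)))%:E)%E.
Proof.
have pos p : 0 <= `|L (p.1 + p.2)| + L (p.1 + p.2).
  exact: normrD_ge0.
have pos' p : (0 <= (gp p * (`|L (p.1 + p.2)| + L (p.1 + p.2)))%:E)%E.
  by rewrite lee_fin; apply: mulr_ge0; [exact: gamma_prod_ge0|].
rewrite /pair_moment /Rintegral fineK// ge0_fin_numE ?integral_ge0//.
apply: (@le_lt_trans _ _ (\int[leb2]_p (2%:E * (gp p * `|L (p.1 + p.2)|)%:E))%E).
  apply: ge0_le_integral => //.
  - apply/measurable_EFinP; apply: measurable_funM; first exact: measurable_gamma_prod.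
    by apply: measurable_funD => //; exact: measurableT_comp.
  - exact: measurable_funeM.
  - move=> p _; rewrite -EFinM lee_fin mulrCA ler_wpM2l ?gamma_prod_ge0//.
    by rewrite mulr_natl mulr2n lerD2l ler_norm.
by rewrite ge0_integralZl// lte_mul_pinfty.
Qed.

(* The log density is [pos_log - neg_log] for eta > 0. Adding [`|L|] to both
   makes them nonnegative, so that Tonelli applies to each, and leaves the
   dependence on yt in the quadratic part of [neg_log]. *)
Definition pos_log (p : l.-tuple RT * RT) : R := `|L p.2| + L p.2.

Definition neg_log yt (p : l.-tuple RT * RT) : R :=
  `|L p.2| + `|p.2| / 2 * sqdist_tuple yt p.1.

Let measurable_L2 : measurable_fun setT (fun p : l.-tuple RT * RT => L p.2).
Proof. by rewrite /log_norm; mfun. Qed.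

Lemma pos_log_ge0 p : 0 <= pos_log p.
Proof. exact: normrD_ge0. Qed.

Lemma neg_log_ge0 yt p : 0 <= neg_log yt p.
Proof. by rewrite addr_ge0// mulr_ge0 ?sqdist_tuple_ge0// divr_ge0. Qed.

Lemma measurable_pos_log : measurable_fun setT pos_log.
Proof. by apply: measurable_funD => //; exact: measurableT_comp. Qed.

Lemma measurable_neg_log yt : measurable_fun setT (neg_log yt).
Proof.
apply: measurable_funD; first exact: measurableT_comp.
apply: measurable_funM; last exact: measurable_sqdist_tuple.
by apply: measurable_funM => //; exact: measurableT_comp.
Qed.

Lemma integral_pos_log_prior :
  (\int[mu]_(psi in Theta) ((pos_log (psi.1.1, psi.2))%:E * ((Lik psi)%:E * Prior psi)) =
   (jc * pm (fun p => `|L (p.1 + p.2)| + L (p.1 + p.2)))%:E)%E.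
Proof.
rewrite (@integral_likelihood_prior_pair pos_log (fun eta _ => `|L eta| + L eta)).
- by rewrite integral_pos_log EFinM.
- exact: measurable_pos_log.
- exact: pos_log_ge0.
- have mL : measurable_fun setT (fun p : R * R => L p.1) by rewrite /log_norm; mfun.
  by apply: measurable_funD => //; exact: measurableT_comp.
move=> eta lam eta0 lam01; rewrite /cond_mean /pos_log/=.
under eq_integral do rewrite EFinM.
rewrite ge0_integralZl//.
- by rewrite integral_cond_pdf// mule1.
- by apply/measurable_EFinP; exact: measurable_cond_pdf.
- by move=> t _; rewrite lee_fin cond_pdf_ge0.
- by rewrite lee_fin normrD_ge0.
Qed.

Lemma gauss_variance_ge0 : 0 <= gauss_variance :> R.
Proof.
apply: fine_ge0; apply: integral_ge0 => t _.
by rewrite lee_fin mulr_ge0 ?gauss_ge0 ?sqr_ge0.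
Qed.

(** Collects whatever in the integral of [neg_log] does not depend on y~. *)
Definition neg_log_const : R :=
  pm (fun p => `|L (p.1 + p.2)|) +
  (\sum_j gauss_variance * d ord0 j * pm (fun=> 1)
  - (\sum_j gauss_variance * (d ord0 j / c ord0 j)) * pm mix_ratio
  + (\sum_j (v j ord0 / c ord0 j) ^+ 2) * pm (fun p => p.1 * mix_ratio p)) / 2.

Lemma integral_neg_log_prior yt :
  (\int[mu]_(psi in Theta) ((neg_log yt (psi.1.1, psi.2))%:E * ((Lik psi)%:E * Prior psi)) =
   (jc * (neg_log_const + pm (fun=> 1) / 2 * (pred_coef1 yt * Ex + pred_coef2 yt * Ey)))%:E)%E.
Proof.
pose quad (eta lam : R) := eta * residual Q yt +
  \sum_j (gauss_variance * (d ord0 j * (1 - lam / c ord0 j)) +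
    eta * ((1 - lam / c ord0 j) * v j ord0 - w yt j) ^+ 2).
have mquad : measurable_fun setT (fun p : R * R => quad p.1 p.2).
  apply: measurable_funD; first by mfun.
  have := @measurable_sum _ (R * R)%type R setT 'I_l (index_enum 'I_l) (fun j p =>
    gauss_variance * (d ord0 j * (1 - p.2 / c ord0 j)) +
    p.1 * ((1 - p.2 / c ord0 j) * v j ord0 - w yt j) ^+ 2); apply => j.
  by mfun.
have quad_ge0 eta lam : 0 < eta -> 0 < lam < 1 -> 0 <= quad eta lam.
  move=> eta0 /andP[lam0 lam1].
  apply: addr_ge0; first by apply: mulr_ge0; [exact: ltW|exact: residual_ge0].
  apply: sumr_ge0 => j _.
  apply: addr_ge0; last by apply: mulr_ge0; [exact: ltW|exact: sqr_ge0].
  apply: mulr_ge0; first exact: gauss_variance_ge0.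
  apply: mulr_ge0; first exact: ltW.
  have cj0 : 0 < c ord0 j by rewrite (lt_le_trans ltr01).
  by rewrite subr_ge0 ler_pdivrMr// mul1r ltW// (lt_le_trans lam1).
transitivity (jc%:E * \int[leb2]_p (gp p *
    (`|L (p.1 + p.2)| + quad (p.1 + p.2) (mix_ratio p) / 2))%:E)%E.
  apply: (@integral_likelihood_prior_pair (neg_log yt)
    (fun eta lam => `|L eta| + quad eta lam / 2)).
  - exact: measurable_neg_log.
  - exact: neg_log_ge0.
  - have mL : measurable_fun setT (fun p : R * R => L p.1) by rewrite /log_norm; mfun.
    apply: measurable_funD; first exact: measurableT_comp.
    by apply: measurable_funM.
  - move=> eta lam eta0 lam01; rewrite /cond_mean /neg_log/= (gtr0_norm eta0).
    exact: cond_mean_sqdist.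
rewrite [RHS]EFinM; congr (_ * _)%E.
pose lin (p : R * R) := (\sum_j gauss_variance * d ord0 j) / 2 +
  (- (\sum_j gauss_variance * (d ord0 j / c ord0 j)) / 2) * mix_ratio p +
  pred_coef1 yt / 2 * p.1 + pred_coef2 yt / 2 * p.2 +
  (\sum_j (v j ord0 / c ord0 j) ^+ 2) / 2 * (p.1 * mix_ratio p).
have gpq p : gp p * (quad (p.1 + p.2) (mix_ratio p) / 2) = gp p * lin p.
  have [/andP[x0 y0]|/gamma_prod_eq0 ->] := boolP ((0 < p.1) && (0 < p.2)); last first.
    by rewrite !mul0r.
  congr (_ * _); rewrite /quad gamma_pair_quad// /lin /mix_ratio; field.
  by rewrite gt_eqF ?addr_gt0.
transitivity (\int[leb2]_p ((gp p * `|L (p.1 + p.2)|)%:E + (gp p * lin p)%:E))%E.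
  by apply: eq_integral => p _; rewrite mulrDr EFinD gpq.
have mlin : measurable_fun setT (fun p => (gp p * lin p)%:E).
  apply/measurable_EFinP; apply: measurable_funM; first exact: measurable_gamma_prod.
  by rewrite /lin /mix_ratio; mfun.
(* The sign cannot be read off [lin], which has negative coefficients; it is inherited from [quad]
   wherever the gamma density is nonzero. *)
have lin0 p : (0 <= (gp p * lin p)%:E)%E.
  rewrite lee_fin -gpq.
  have [/andP[x0 y0]|/gamma_prod_eq0 ->] := boolP ((0 < p.1) && (0 < p.2)); last first.
    by rewrite mul0r.
  apply: mulr_ge0; first exact: gamma_prod_ge0.
  by rewrite divr_ge0// quad_ge0 ?addr_gt0 ?mix_ratio_itv.
rewrite ge0_integralD// integral_abs_log integral_pair_linear// -EFinD; congr EFin.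
rewrite pair_moment_fst// pair_moment_snd// /neg_log_const -mulr_suml.
by ring.
Qed.

(** [param_measure] is typed as a bare set function; this is the same product with its measure
    structure. *)
Let param_mu : {measure set Psi -> \bar R} :=
  (lebesgue_tuple l \x lebesgue_tuple q \x lebesgue_measure)%E.

Definition exponent_const : R :=
  (pm (fun p => `|L (p.1 + p.2)| + L (p.1 + p.2)) - neg_log_const) / pm (fun=> 1) +
  (Ex + Ey) / 2 * (post_ratio ^+ 2 * \sum_j (v j ord0 / c ord0 j) ^+ 2).

Lemma integral_post_log yt :
  mu.-integrable Theta (post_log mu Theta Lik Prior (future_pdf Q) yt) /\
  (\int[mu]_(psi in Theta) post_log mu Theta Lik Prior (future_pdf Q) yt psi =
   (exponent_const - (Ex + Ey) / 2 * sqnorm (yt - Q *m theta_bayes))%:E)%E.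
Proof.
have mproj : measurable_fun setT (fun psi : Psi => (psi.1.1, psi.2)).
  by apply: measurable_fun_pair; mfun.
have m1 : measurable_fun setT (fun psi : Psi => pos_log (psi.1.1, psi.2)).
  exact: (measurableT_comp measurable_pos_log mproj).
have m2 : measurable_fun setT (fun psi : Psi => neg_log yt (psi.1.1, psi.2)).
  exact: (measurableT_comp (measurable_neg_log yt) mproj).
have mLP : measurable_fun Theta (fun psi => (Lik psi)%:E * Prior psi)%E.
  exact: measurable_likelihood_prior.
have I0 : (\int[mu]_(psi in Theta) posterior mu Theta Lik Prior psi < +oo)%E.
  have := @integral_posterior (fun=> 1) (pm (fun=> 1)) (measurable_cst _) (fun=> ler01).
  under eq_integral do rewrite mul1e.
  under [X in _ -> X = _]eq_integral do rewrite mul1e.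
  by move=> ->; [rewrite ltry|exact: marginalE].
have I1 := integral_posterior m1 (fun _ => pos_log_ge0 _) integral_pos_log_prior.
have I2 := integral_posterior m2 (fun _ => neg_log_ge0 _ _) (integral_neg_log_prior yt).
have mP : measurable_fun Theta (posterior mu Theta Lik Prior).
  by rewrite /posterior; apply: emeasurable_funM.
have P0 psi : Theta psi -> (0 <= posterior mu Theta Lik Prior psi)%E.
  move=> H; rewrite /posterior mule_ge0 ?lik_prior_ge0// lee_fin invr_ge0 marginalE/=.
  exact: ltW.
have [iD ID] := @integral_diff_density _ _ _ param_mu Theta _ _ _ _ _
  (@measurable_param_space R l q) m1 m2 mP (fun _ => pos_log_ge0 _) (fun _ => neg_log_ge0 _ _)
  P0 I0 I1 I2.
have E : {in Theta, (fun psi => (pos_log (psi.1.1, psi.2) - neg_log yt (psi.1.1, psi.2))%:E *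
    posterior mu Theta Lik Prior psi)%E =1 post_log mu Theta Lik Prior (future_pdf Q) yt}.
  (* On the parameter space |eta| = eta, and the absolute value added to both parts cancels, which
     leaves the log density. *)
  move=> psi; rewrite inE => eta0; rewrite /post_log /future_pdf mvn_pdf_expR// expRK.
  congr (_%:E * _)%E; rewrite /pos_log /neg_log/= (gtr0_norm eta0) sqdist_decomp//.
  have -> : sqnorm (theta_of psi - Q^T *m yt) = \sum_j (tnth psi.1.1 j - w yt j) ^+ 2.
    apply: eq_bigr => j _; congr (_ ^+ 2).
    by rewrite !mxE.
  by rewrite /sqdist_tuple /eta_of; ring.
split; first exact: (@eq_integrable _ _ _ param_mu Theta (@measurable_param_space R l q) _ _ E iD).
rewrite -(eq_integral _ _ E) ID; congr EFin.
rewrite pred_coef_complete_square /exponent_const.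
have m10 : pm (fun=> 1) != 0 by rewrite gt_eqF// pair_moment1_gt0.
set H := Ex + Ey; move: (pm (fun=> 1)) m10 => M1 M10.
by field.
Qed.

End posterior_expectation.

(** * The predictive density and its parameters *)

Section predictive.
Context {R : realType}.

(** The exponential is [k] times a normal density of precision H. As that density has integral 1,
    [k] is also the normalising integral and cancels, and K with it. *)
Lemma D1_predictive_gaussian d0 (Psi : measurableType d0) (mu : set Psi -> \bar R)
    (Theta : set Psi) (lik : Psi -> R) (prior : Psi -> \bar R) (m : nat)
    (p : 'cV[R]_m -> Psi -> R) (K H : R) (mean : 'cV[R]_m) : 0 < H ->
  (forall yt, \int[mu]_(psi in Theta) post_log mu Theta lik prior p yt psi =
    (K - H / 2 * sqnorm (yt - mean))%:E)%E ->
  forall yt, D1_predictive mu Theta lik prior p yt = mvn_pdf mean (H^-1)%:M yt.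
Proof.
move=> H0 I yt.
pose k := expR (K - log_norm m H).
have k0 : 0 < k by exact: expR_gt0.
have E y : exp_post_log mu Theta lik prior p y = k * mvn_pdf mean (H^-1)%:M y.
  rewrite /exp_post_log I/= mvn_pdf_expR// -expRD; congr expR; ring.
have Hi : 0 < H^-1 by rewrite invr_gt0.
rewrite /D1_predictive E.
have -> : (\int[lebesgue_tuple m]_z (exp_post_log mu Theta lik prior p (colt z))%:E = k%:E)%E.
  rewrite -[RHS]mule1 -(integral_mvn_pdf_scalar mean Hi) -ge0_integralZl//.
  - by apply: eq_integral => z _; rewrite E EFinM.
  - apply/measurable_EFinP.
    apply: (eq_measurable_fun (fun z =>
      \prod_i gauss H (mean i ord0) (tnth z i))); last first.
      by apply: (@measurable_fun_tnth _ _ (fun i => gauss H (mean i ord0))) => i;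
        apply: measurable_gauss.
    move=> z _; rewrite mvn_pdf_scalar// invrK.
    by apply: eq_bigr => i _; rewrite mxE.
  - by move=> z _; rewrite lee_fin mvn_pdf_expR// expR_ge0.
  - by rewrite lee_fin ltW.
by rewrite /= mulrAC divff ?mul1r// gt_eqF.
Qed.

(** Since [rateA] = s (1 + W) / 2, [rateB] = s / 2 and nu = 2 [shapeA] / r, one gets E x = nu r / (s
    (1 + W)) and E y = r / s. Hence 1 / (E x + E y) = (s / r) (1 + W) / (nu + 1 + W). *)
Lemma bayes_estimators l q r (c d : 'rV[R]_l) (gamma a s : R) (v : 'cV[R]_l)
    (vs : 'cV[R]_q) : (0 < r)%N -> (forall i, 1 <= c ord0 i) ->
  (forall i, 0 < d ord0 i) -> 1 <= gamma -> 0 < s ->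
  - ((l + q)%:R / 2) - 1 < a ->
  let nu := ((l + q)%:R + 2 * a + 2) / r%:R in
  theta_hat (diag_mx d) (diag_mx c) gamma nu v vs s =
    theta_bayes r c d gamma a s v vs /\
  sigma2_hat r (diag_mx d) (diag_mx c) gamma nu v vs s =
    (shapeA l q a / rateA c d gamma s v vs + shapeB r / rateB s)^-1.
Proof.
move=> r0 c1 d0 g1 s0 a0 nu.
have c0 i : c ord0 i != 0 by rewrite gt_eqF// (lt_le_trans ltr01).
have dn0 i : d ord0 i != 0 by rewrite gt_eqF.
pose W := W_stat (diag_mx d) (diag_mx c) gamma v vs s.
have WE : s * W = marg_quad c d v + marg_quad (const_mx gamma) (const_mx 1) vs.
  rewrite /W /W_stat mulrC divfK ?gt_eqF// invmx_diag// invmx_diag//.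
  congr (_ + _).
    rewrite -(mulmxA v^T).
    have -> : diag_mx (\row_i (c ord0 i)^-1) *m diag_mx (\row_i (d ord0 i)^-1) =
        diag_mx (\row_i (d ord0 i * c ord0 i)^-1).
      rewrite mul_diag_mx; apply/matrixP => i j; rewrite !mxE.
      by case: eqVneq => [->|_]; rewrite ?mulr1n ?mulr0n ?mulr0// invfM mulrC.
    by rewrite quad_diag_mx; apply: eq_bigr => i _; rewrite mxE mulrC.
  by rewrite mulr_suml; apply: eq_bigr => i _; rewrite !mxE mul1r.
have W0 : 0 <= W.
  rewrite -(pmulr_rge0 _ s0) WE addr_ge0// marg_quad_ge0// => i; rewrite mxE//.
have A0 : 0 < shapeA l q a by exact: shapeA_gt0.
have rR : 0 < r%:R :> R by rewrite ltr0n.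
have nuE : nu = 2 * shapeA l q a / r%:R by rewrite /nu /shapeA; field; rewrite gt_eqF.
have rAE : rateA c d gamma s v vs = s * (1 + W) / 2 by rewrite /rateA -WE; ring.
have nu0 : 0 < nu by rewrite nuE divr_gt0// mulr_gt0.
have W1 : 0 < 1 + W by rewrite ltr_pwDl.
have D0 : 0 < nu + 1 + W by rewrite -addrA addr_gt0.
have S0 : 0 < shapeA l q a * 2 + r%:R * (1 + W) by rewrite addr_gt0// mulr_gt0.
have ratioE : nu / (nu + 1 + W) = post_ratio r c d gamma a s v vs.
  rewrite /post_ratio rAE nuE /shapeB /rateB.
  by field; rewrite !gt_eqF.
split.
  apply/matrixP => i j; rewrite (ord1 j) /theta_hat -/W ratioE invmx_diag//.
  rewrite mulmxBl mul1mx -scalemxAl mul_diag_mx !mxE; ring.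
rewrite /sigma2_hat -/W ratioE /post_ratio rAE /shapeB /rateB.
by field; rewrite !gt_eqF.
Qed.

End predictive.

(** The first two clauses give the third its meaning: they exclude that the posterior or the
    exponent is a default value produced by [fine] or by a divergent integral. *)
Theorem theorem3p2 (R : realType) (n k m l : nat)
    (hk : (1 <= k)%N) (hnk : (k < n)%N) (hm : (1 <= m)%N) (hl : l = minn k m)
    (d : 'rV[R]_l)
    (hd_pos : forall i : 'I_l, 0 < d ord0 i)
    (hd_dec : forall i j : 'I_l, (i <= j)%N -> d ord0 j <= d ord0 i)
    (Q : 'M[R]_(m, l)) (hQ : Q^T *m Q = 1%:M)
    (c : 'rV[R]_l) (hc : forall i : 'I_l, 1 <= c ord0 i)
    (gamma : R) (hgamma : 1 <= gamma)
    (a : R) (ha : - (k%:R / 2) - 1 < a)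
    (v : 'cV[R]_l) (vs : 'cV[R]_(k - l)) (s : R) (hs : 0 < s) :
  let D := diag_mx d in
  let C := diag_mx c in
  let b : R := (n - k)%N%:R / 2 - 1 in
  let nu := (k%:R + 2 * a + 2) / (n - k)%N%:R in
  let mu := param_measure R l (k - l) in
  let Theta := param_space R l (k - l) in
  let lik := likelihood (n - k) D v vs s in
  let prior := hier_prior D C gamma a b in
  let p := future_pdf Q in
  [/\ (0 < marginal mu Theta lik prior < +oo)%E,
      forall yt : 'cV[R]_m,
        mu.-integrable Theta (post_log mu Theta lik prior p yt) &
      forall yt : 'cV[R]_m,
        D1_predictive mu Theta lik prior p yt =
        mvn_pdf (Q *m theta_hat D C gamma nu v vs s)
                (sigma2_hat (n - k) D C gamma nu v vs s)%:M yt].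
Proof.
move=> D C b nu mu Theta lik prior p.
have r_gt0 : (0 < n - k)%N by rewrite subn_gt0.
(* The subtraction is exact because l = min(k, m) <= k. For m >= k it gives q = 0, and mu and vs
   live on R^0. *)
have lk : (l + (k - l) = k)%N by rewrite subnKC// hl geq_minl.
have a_gt : - ((l + (k - l))%N%:R / 2) - 1 < a by rewrite lk.
have PL := integral_post_log v vs r_gt0 hc hd_pos hgamma hs a_gt hQ.
split.
- by rewrite (marginalE v vs r_gt0 hc hd_pos hgamma hs a_gt) ltry
    -(marginalE v vs r_gt0 hc hd_pos hgamma hs a_gt) marginal_gt0.
- by move=> yt; have [] := PL yt.
move=> yt.
set H := shapeA l (k - l) a / rateA c d gamma s v vs + shapeB (n - k) / rateB s.
have H0 : 0 < H by exact: post_precision_gt0.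
have nuE : nu = ((l + (k - l))%N%:R + 2 * a + 2) / (n - k)%N%:R by rewrite lk.
have [-> ->] : theta_hat D C gamma nu v vs s =
      theta_bayes (n - k) c d gamma a s v vs /\
    sigma2_hat (n - k) D C gamma nu v vs s = H^-1.
  by rewrite nuE; exact: bayes_estimators.
by apply: D1_predictive_gaussian => // z; have [_ ->] := PL z.
Qed.
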